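(* Let $V:\mathbb{R}^3\to S^2$ be a unit vector field defining a fibration of $\mathbb{R}^3$ by oriented lines, let $U=V(\mathbb{R}^3)\subset S^2$, and for $u\in U$ let $S_u=u^\perp\cap V^{-1}(u)$. (a) If the fibration is not a $1$-parameter fibration, then every $S_u$ ($u\in U$) is convex (in particular, connected). (b) If $u\in U$ is such that $S_u$ is compact, then continuity at infinity holds for the direction $u$, and $-u\notin U$. (c) If $S_u$ is compact for all $u\in U$, then $U$ is a convex subset of $S^2$. (d) If $S_u$ is not compact for all $u\in U$ (that is, every $S_u$ is noncompact), then every $S_u$ is a union of one or more lines, hence the fibration is a $1$-parameter fibration.
   Context: A fibration of $\mathbb{R}^3$ by oriented lines is given by a (continuous) unit vector field $V:\mathbb{R}^3\to S^2$ all of whose integral curves are oriented straight lines; these lines are the fibers. For $u\in U=V(\mathbb{R}^3)$, $u^\perp$ denotes the linear plane through the origin of $\mathbb{R}^3$ orthogonal to $u$, and $S_u=u^\perp\cap V^{-1}(u)$, a closed subset of $u^\perp$. The fibration is a $1$-parameter fibration if there is a foliation of $\mathbb{R}^3$ by parallel planes $\{P_t\}$ each of which is individually fibered by lines of the fibration (every fiber lies in some $P_t$). A direction $u\in U$ exhibits continuity at infinity if for every sequence $\{p_n\}\subset\mathbb{R}^3$ with $|p_n|\to\infty$ and $\frac{p_n}{|p_n|}\to\pm u$ (i.e. convergence to the class of $\pm u$ in $\mathbb{R}P^2$), one has $V(p_n)\to u$. Convexity of a subset of $S^2$ is in the geodesic sense: for any two distinct non-antipodal points of the subset, it contains the shorter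 great circle arc joining them. *)

(* Defs.v *)
From HB Require Import structures.
From mathcomp Require Import all_boot all_order all_algebra.
From mathcomp Require Import all_classical all_reals all_analysis.

Set Implicit Arguments.
Unset Strict Implicit.
Unset Printing Implicit Defensive.

Import Order.TTheory GRing.Theory Num.Theory.
Import numFieldNormedType.Exports.

Local Open Scope classical_set_scope.
Local Open Scope ring_scope.

(** The norm `|_| of 'rV[R]_3 is the sup norm; it gives the usual topology of
    R^3, but metric notions have to go through the Euclidean norm [enorm]. *)

Definition dot (R : realType) (u v : 'rV[R]_3) : R := (u *m v^T) 0 0.

Definition enorm (R : realType) (u : 'rV[R]_3) : R := Num.sqrt (dot u u).

Definition line (R : realType) (p v : 'rV[R]_3) : set 'rV[R]_3 :=
  [set p + t *: v | t in [set: R]].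

Definition is_line (R : realType) (L : set 'rV[R]_3) : Prop :=
  exists p v : 'rV[R]_3, v != 0 /\ L = line p v.

Definition plane (R : realType) (n : 'rV[R]_3) (t : R) : set 'rV[R]_3 :=
  [set x | dot n x = t].

Definition integral_curve (R : realType) (V : 'rV[R]_3 -> 'rV[R]_3)
    (g : R -> 'rV[R]_3) : Prop :=
  forall t : R, is_derive t (1 : R) g (V (g t)).

(** A continuous field need not have unique integral curves, so the two halves
    of "the integral curves are the fibers" are both required: the oriented
    line through each point is an integral curve, and every integral curve is a
    straight line. *)
Definition line_fibration (R : realType) (V : 'rV[R]_3 -> 'rV[R]_3) : Prop :=
  [/\ continuous V,
      forall p, enorm (V p) = 1,
      forall p, integral_curve V (fun t : R => p + t *: V p) &
      forall g, integral_curve V g ->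
        exists p v : 'rV[R]_3, forall t, g t = p + t *: v].

Definition fiber (R : realType) (V : 'rV[R]_3 -> 'rV[R]_3) (p : 'rV[R]_3) :
  set 'rV[R]_3 := line p (V p).

Definition one_parameter (R : realType) (V : 'rV[R]_3 -> 'rV[R]_3) : Prop :=
  exists2 n : 'rV[R]_3, n != 0 &
    forall p, exists t : R, fiber V p `<=` plane n t.

Definition dirs (R : realType) (V : 'rV[R]_3 -> 'rV[R]_3) : set 'rV[R]_3 :=
  range V.

Definition Sdir (R : realType) (V : 'rV[R]_3 -> 'rV[R]_3) (u : 'rV[R]_3) :
  set 'rV[R]_3 := plane u 0 `&` V @^-1` [set u].

(** The classes of the unit vectors x_k converge to the class of the unit
    vector [u] in RP^2, i.e. modulo antipodes, iff their chordal distance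
    min(|x_k - u|, |x_k + u|) to {u, -u} tends to 0. *)
Definition cvg_RP2 (R : realType) (x : nat -> 'rV[R]_3) (u : 'rV[R]_3) : Prop :=
  Num.min (enorm (x k - u)) (enorm (x k + u)) @[k --> \oo] --> (0 : R).

Definition continuous_at_infinity (R : realType) (V : 'rV[R]_3 -> 'rV[R]_3)
    (u : 'rV[R]_3) : Prop :=
  forall p : nat -> 'rV[R]_3,
    enorm (p k) @[k --> \oo] --> +oo ->
    cvg_RP2 (fun k => (enorm (p k))^-1 *: p k) u ->
    V (p k) @[k --> \oo] --> u.

(** For distinct, non-antipodal unit vectors [u], [v], the great circle through
    them is the unit circle of their span, and its shorter arc from [u] to [v]
    is the part lying in the cone they generate. *)
Definition short_arc (R : realType) (u v : 'rV[R]_3) : set 'rV[R]_3 :=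
  [set x | enorm x = 1 /\
    exists a b : R, [/\ 0 <= a, 0 <= b & x = a *: u + b *: v]].

Definition geodesically_convex (R : realType) (A : set 'rV[R]_3) : Prop :=
  forall u v, A u -> A v -> u != v -> u != - v -> short_arc u v `<=` A.

Definition union_of_lines (R : realType) (A : set 'rV[R]_3) : Prop :=
  exists F : set (set 'rV[R]_3),
    [/\ F !=set0, F `<=` @is_line R & A = \bigcup_(L in F) L].

(* Main.v *)
Require Import Defs.
From HB Require Import structures.
From mathcomp Require Import all_boot all_order all_algebra.
From mathcomp Require Import all_classical all_reals all_analysis.
From mathcomp Require Import ring lra.
Import Order.TTheory GRing.Theory Num.Theory.
Import numFieldNormedType.Exports.
Local Open Scope classical_set_scope.
Local Open Scope ring_scope.

Set Implicit Arguments.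
Unset Strict Implicit.
Unset Printing Implicit Defensive.

(** The field [V] is constant along its own fibers, so two fibers that meet
    coincide. Everything follows from this rigidity and from the continuity of
    [V], by elementary connectedness and compactness arguments.

    Gaps and tubes. Take two parallel fibers of direction [u] or [-u] such that
    no fiber in the open plane strip between them is parallel to [u]; every
    fiber through the strip is then transverse to the plane. The union [W] of
    these fibers (the tube of the gap) is open, and a limit of points of [W]
    outside [W] lies on a fiber of direction [u] or [-u] ([tube_frontier]).
    Hence [W] is invariant under translation along [u] ([tube_translate]), and
    it meets the plane of the strip in the strip only. If all directions in the
    strip lie in one plane, the plane spanned at the edge of [W] is made of
    fibers parallel to [u] ([coplanar_strip_one_parameter]). No other fiber can
    cross it, so the fibration is a 1-parameter one.

    Part (a). Suppose that [V] takes the value [u] at two points but not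
    everywhere on the segment between them. Either two disjoint gaps of
    direction [u] lie on this segment, and then the fibers of both tubes,
    projected along [u], are disjoint lines of a plane, hence all parallel
    ([two_gaps_one_parameter]); or there is a gap with direction [u] at both
    edges. In that case an intermediate value argument produces two parallel
    fibers of another direction [v] through the strip. The tube of the gap
    between them is invariant along [v] and sits inside the first tube, so the
    planes spanned by [v] and its fibers meet the first strip in full lines;
    these must be parallel to [u], and again all directions are coplanar
    ([same_direction_gap_one_parameter]). So, unless the fibration is a
    1-parameter one, [V^-1(u)] is convex.

    Part (b). If [S_u] is compact, surround it in its plane by a small bounded
    open set [D] on whose frontier [V] differs from [u]. Fibers through that
    frontier leave a cone around the axis [u]; an open-closed argument in each
    plane orthogonal to [u] then shows that all points deep inside the cone lie
    on fibers through [D], where [V] is close to [u] ([covering]).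

    Part (c). Let [n] be orthogonal to [u] and [v]. By [covering] the function
    [n . V] takes both signs, hence it does so on every plane [n . x = t], and
    it vanishes there. The fibers contained in such a plane have a single
    direction, because two fibers of one plane are parallel, and opposite
    directions are excluded by (b). This direction moves continuously with [t] on the great circle of
    [u] and [v]; it joins [u] to [v] and avoids [-u] and [-v], so it runs
    through the short arc.

    Part (d). Suppose that no [S_u] is compact and the fibration is not a
    1-parameter one. Then each [V^-1(u)] is convex and contains a half-plane
    but no plane, so some linear form [l] is positive on all recession
    directions of [S_u] ([strict_functional]) and attains its minimum over
    [S_u] at some [z]. Near [z] every point [q] starts a ray on which [V] is
    constant and [l] grows at a definite rate ([local_rays]). Following such
    rays from a small segment just below the level of [z] to a parallel segment
    just above it, [u] is reached by continuity and convexity, so [V] equals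
    [u] at a point below the minimum, a contradiction. Finally, in a 1-parameter
    fibration the planes are filled with parallel fibers, so [S_u] is a union
    of lines. *)

(** * Linear algebra in dimension three *)

Section LinearAlgebra.
Variable R : realType.
Implicit Types (a b c p q u v w e n x y : 'rV[R]_3) (s t : R).

Lemma row3P x y : x 0 0 = y 0 0 -> x 0 1 = y 0 1 -> x 0 2 = y 0 2 -> x = y.
Proof.
move=> h0 h1 h2; apply/rowP => i.
case: i => [[|[|[|//]]] Hi].
- by rewrite (_ : Ordinal Hi = 0) //; apply: val_inj.
- by rewrite (_ : Ordinal Hi = 1) //; apply: val_inj.
- by rewrite (_ : Ordinal Hi = 2) //; apply: val_inj.
Qed.

Lemma dotE u v : dot u v = u 0 0 * v 0 0 + u 0 1 * v 0 1 + u 0 2 * v 0 2.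
Proof.
rewrite /dot mxE !big_ord_recl big_ord0 !mxE addr0 addrA.
by congr (_ * _ + _ * _ + _ * _); congr (_ _ _); apply: val_inj.
Qed.

Definition cross u v : 'rV[R]_3 :=
  \row_j [:: u 0 1 * v 0 2 - u 0 2 * v 0 1;
             u 0 2 * v 0 0 - u 0 0 * v 0 2;
             u 0 0 * v 0 1 - u 0 1 * v 0 0]`_j.

Lemma cross0E u v : cross u v 0 0 = u 0 1 * v 0 2 - u 0 2 * v 0 1.
Proof. by rewrite mxE. Qed.
Lemma cross1E u v : cross u v 0 1 = u 0 2 * v 0 0 - u 0 0 * v 0 2.
Proof. by rewrite mxE. Qed.
Lemma cross2E u v : cross u v 0 2 = u 0 0 * v 0 1 - u 0 1 * v 0 0.
Proof. by rewrite mxE. Qed.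

Definition crossE := (cross0E, cross1E, cross2E).

End LinearAlgebra.

Ltac vring := apply: row3P; rewrite ?dotE ?(crossE, mxE) ?dotE ?(crossE,mxE); ring.
Ltac dring := rewrite ?dotE ?(crossE, mxE) ?dotE ?(crossE,mxE); ring.

Section VectorIdentities.
Variable R : realType.
Implicit Types (a b c p q u v w e n x y : 'rV[R]_3) (s t : R).

Lemma dotC u v : dot u v = dot v u. Proof. dring. Qed.
Lemma dotDr u v w : dot u (v + w) = dot u v + dot u w. Proof. dring. Qed.
Lemma dotZr u s v : dot u (s *: v) = s * dot u v. Proof. dring. Qed.
Lemma dotNr u v : dot u (- v) = - dot u v. Proof. dring. Qed.
Lemma dotDl u v w : dot (v + w) u = dot v u + dot w u. Proof. dring. Qed.
Lemma dotZl u s v : dot (s *: v) u = s * dot v u. Proof. dring. Qed.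
Lemma dotNl u v : dot (- v) u = - dot v u. Proof. dring. Qed.
Lemma dot0r u : dot u 0 = 0. Proof. dring. Qed.
Lemma dot0l u : dot 0 u = 0. Proof. dring. Qed.

Definition dotL := (dotDr, dotZr, dotNr, dotDl, dotZl, dotNl, dot0r, dot0l).

Lemma dot_ge0 u : 0 <= dot u u.
Proof. by rewrite dotE !addr_ge0 // -expr2 sqr_ge0. Qed.

Lemma dot_eq0 u : (dot u u == 0) = (u == 0).
Proof.
apply/idP/idP => [|/eqP ->]; last by rewrite dot0l.
rewrite dotE -!expr2 => /eqP h; apply/eqP; apply: row3P; rewrite mxE; nra.
Qed.

Lemma dot_gt0 u : u != 0 -> 0 < dot u u.
Proof. by move=> u0; rewrite lt_neqAle dot_ge0 eq_sym dot_eq0 u0. Qed.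

Lemma cross_dotl u v : dot u (cross u v) = 0. Proof. dring. Qed.
Lemma cross_dotr u v : dot v (cross u v) = 0. Proof. dring. Qed.

Lemma crossL u v : dot (cross u v) (cross u v) = dot u u * dot v v - dot u v ^+ 2.
Proof. dring. Qed.

Lemma cauchy_dot u v : dot u v ^+ 2 <= dot u u * dot v v.
Proof. by rewrite -subr_ge0 -crossL dot_ge0. Qed.

(** Cramer's rule for the matrix of rows [u], [e], [n]. *)
Lemma cramer u e n x :
  dot (cross u e) n *: x =
  dot u x *: cross e n + dot e x *: cross n u + dot n x *: cross u e.
Proof. vring. Qed.
End VectorIdentities.

(** * Continuity, connectedness and intermediate values *)

Section Topology.
Variable R : realType.

Lemma cont_coord (T : topologicalType) (f : T -> 'rV[R]_3) i :
  continuous f -> continuous (fun p => f p 0 i).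
Proof.
move=> cf x; apply: (@continuous_comp _ _ _ f (fun M : 'rV[R]_3 => M 0 i)).
  exact: cf.
exact: coord_continuous.
Qed.

Lemma cont_dot (T : topologicalType) (f g : T -> 'rV[R]_3) :
  continuous f -> continuous g -> continuous (fun p => dot (f p) (g p)).
Proof.
move=> cf cg x.
under eq_fun do rewrite dotE.
by apply: cvgD; [apply: cvgD|]; apply: cvgM; apply: cont_coord.
Qed.

Lemma cont_add (T : topologicalType) (f g : T -> 'rV[R]_3) :
  continuous f -> continuous g -> continuous (fun p => f p + g p).
Proof. by move=> cf cg x; apply: cvgD; [exact: cf|exact: cg]. Qed.

Lemma cont_opp (T : topologicalType) (f : T -> 'rV[R]_3) :
  continuous f -> continuous (fun p => - f p).
Proof. by move=> cf x; apply: cvgN; exact: cf. Qed.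

Lemma cont_scale (T : topologicalType) (k : T -> R) (f : T -> 'rV[R]_3) :
  continuous k -> continuous f -> continuous (fun p => k p *: f p).
Proof. by move=> ck cf x; apply: cvgZ; [exact: ck|exact: cf]. Qed.

Lemma cont_addR (T : topologicalType) (f g : T -> R) :
  continuous f -> continuous g -> continuous (fun p => f p + g p).
Proof. by move=> cf cg x; apply: cvgD; [exact: cf|exact: cg]. Qed.

Lemma cont_oppR (T : topologicalType) (f : T -> R) :
  continuous f -> continuous (fun p => - f p).
Proof. by move=> cf x; apply: cvgN; exact: cf. Qed.

Lemma cont_mulR (T : topologicalType) (f g : T -> R) :
  continuous f -> continuous g -> continuous (fun p => f p * g p).
Proof. by move=> cf cg x; apply: cvgM; [exact: cf|exact: cg]. Qed.

Lemma cont_const (T U : topologicalType) (c : U) : continuous (fun _ : T => c).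
Proof. by move=> x; exact: cvg_cst. Qed.

Lemma cont_id (T : topologicalType) : continuous (fun x : T => x).
Proof. by move=> x; exact: cvg_id. Qed.

Lemma cont_comp (S T U : topologicalType) (f : S -> T) (g : T -> U) :
  continuous f -> continuous g -> continuous (fun x => g (f x)).
Proof. by move=> cf cg x; apply: continuous_comp; [exact: cf|exact: cg]. Qed.

Lemma cont_pair (S T U : topologicalType) (f : S -> T) (g : S -> U) :
  continuous f -> continuous g -> continuous (fun x => (f x, g x)).
Proof. by move=> cf cg x; apply: (@cvg_pair _ _ _ _ _ _ _ _ _ f g (cf x) (cg x)). Qed.

Lemma open_pos (T : topologicalType) (f : T -> R) :
  continuous f -> open [set x | 0 < f x].
Proof.
move=> cf; rewrite (_ : [set x | _] = f @^-1` [set y | 0 < y]) //.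
by apply: open_comp; [move=> x _; exact: cf|exact: open_gt].
Qed.

Lemma closed_nneg (T : topologicalType) (f : T -> R) :
  continuous f -> closed [set x | 0 <= f x].
Proof.
move=> cf; rewrite (_ : [set x | _] = f @^-1` [set y | 0 <= y]) //.
by apply: closed_comp; [move=> x _; exact: cf|exact: closed_ge].
Qed.

Lemma closed_zero (T : topologicalType) (f : T -> R) :
  continuous f -> closed [set x | f x = 0].
Proof.
move=> cf; rewrite (_ : [set x | _] = f @^-1` [set y | y = 0]) //.
by apply: closed_comp; [move=> x _; exact: cf|exact: closed_eq].
Qed.

Lemma closure_nneg (T : topologicalType) (A : set T) (f : T -> R) x :
  continuous f -> (forall y, A y -> 0 <= f y) -> closure A x -> 0 <= f x.
Proof.
move=> cf Af clx.
have : closure [set y | 0 <= f y] x by apply: closureS clx => y; exact: Af.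
by move/(closed_nneg cf).
Qed.

(** Connectedness of the unit interval, in the form used throughout: along a
    path that starts in the open set [A], being in [A] propagates to the end as
    soon as it survives passing to limits. *)
Lemma path_open_closed (T : topologicalType) (A : set T) (g : R -> T) :
  continuous g -> open A -> A (g 0) ->
  (forall t, 0 <= t <= 1 -> closure A (g t) -> A (g t)) -> A (g 1).
Proof.
move=> cg oA A0 clA.
have oB : open (g @^-1` A) by apply: open_comp => // x _; exact: cg.
have := @segment_connected R 0 1.
move=> /(_ (`[0,1]%classic `&` g @^-1` A)) H.
have -> : A (g 1) = (g @^-1` A) 1 by [].
suff -> : (g @^-1` A) 1 = ((`[0,1]%classic `&` g @^-1` A) 1).
  rewrite H; first by rewrite /= in_itv /= ler01 lexx.
  - by exists 0; split => //=; rewrite in_itv /= lexx ler01.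
  - by exists (g @^-1` A).
  - exists (g @^-1` closure A).
      by apply: closed_comp; [move=> x _; exact: cg|exact: closed_closure].
    apply/seteqP; split => t [] /=; rewrite in_itv /= => t01 At; split; rewrite ?in_itv //=.
      exact: subset_closure.
    exact: clA.
apply/propext; split; last by case.
by move=> ?; split => //=; rewrite in_itv /= ler01 lexx.
Qed.

Lemma ivt0 (f : R -> R) a b : continuous f -> a <= b ->
  f a * f b <= 0 -> exists2 c, a <= c <= b & f c = 0.
Proof.
move=> cf ab fab.
have [] := @IVT R f a b 0 ab.
- by apply: continuous_subspaceT.
- rewrite /Num.min /Num.max; case: ifP => h; nra.
- by move=> c; rewrite in_itv /= => cab fc; exists c.
Qed.

(** The supremum of the part of [C] below [b]. *)
Lemma last_point_in (C : set R) a b : closed C -> a <= b -> C a -> ~ C b ->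
  exists s, [/\ a <= s, s < b, C s & forall t, s < t <= b -> ~ C t].
Proof.
move=> cC ab Ca Cb.
pose B := C `&` `[a, b]%classic.
have hB : has_sup B.
  split; first by exists a; split => //=; rewrite in_itv /= lexx.
  by exists b => x [_] /=; rewrite in_itv /= => /andP[].
have cB : closed B by apply: closedI => //; exact: itv_closed.
have Bs : B (sup B).
  by apply: cB; have [h0 h1] := hB; apply: closure_sup.
case: (Bs) => Cs /=; rewrite in_itv /= => /andP[as_ sb].
exists (sup B); split => //.
  rewrite lt_neqAle sb andbT; apply/eqP => e; apply: Cb; rewrite -e; exact: Cs.
move=> t /andP[st tb] Ct.
have : t <= sup B.
  apply: sup_ubound; first exact: hB.2.
  by split => //=; rewrite in_itv /= tb andbT; apply: (le_trans as_); exact: ltW.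
by rewrite leNgt st.
Qed.

Lemma first_point_in (C : set R) a b : closed C -> a <= b -> C b -> ~ C a ->
  exists s, [/\ a < s, s <= b, C s & forall t, a <= t < s -> ~ C t].
Proof.
move=> cC ab Cb Ca.
have cN : closed (-%R @^-1` C).
  by apply: closed_comp => // x _; apply: cvgN; exact: cvg_id.
have [|||s [h1 h2 h3 h4]] := @last_point_in (-%R @^-1` C) (- b) (- a) cN.
- by rewrite lerN2.
- by rewrite /= opprK.
- by rewrite /= opprK.
exists (- s); split.
- by lra.
- by lra.
- exact: h3.
move=> t /andP[t1 t2] Ct; apply: (h4 (- t)).
  by apply/andP; split; lra.
by rewrite /= opprK.
Qed.

End Topology.

(** * Frames and the rigidity of fibers *)

Section Frame.
Variable R : realType.
Implicit Types (u v e x y : 'rV[R]_3).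

Definition par u v := v = u \/ v = - u.

Definition unit_frame u e := [/\ dot u u = 1, dot e e = 1 & dot u e = 0].

Lemma frame_exp u e x : unit_frame u e ->
  x = dot u x *: u + dot e x *: e + dot (cross u e) x *: cross u e.
Proof.
move=> [uu ee ue].
have nn : dot (cross u e) (cross u e) = 1 by rewrite crossL uu ee ue; ring.
have en : cross e (cross u e) = u.
  transitivity (dot e e *: u - dot u e *: e); first by vring.
  by rewrite ee ue scale1r scale0r subr0.
have nu : cross (cross u e) u = e.
  transitivity (dot u u *: e - dot u e *: u); first by vring.
  by rewrite uu ue scale1r scale0r subr0.
by rewrite -[LHS]scale1r -nn cramer en nu.
Qed.

(** Two points with the same coordinates on [e] and [cross u e] differ along
    [u]; this replaces the projection along [u] to a plane. *)
Lemma frame_eq u e x y : unit_frame u e ->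
  dot e x = dot e y -> dot (cross u e) x = dot (cross u e) y ->
  x = y + (dot u x - dot u y) *: u.
Proof.
move=> F exy nxy; set d := dot u x - dot u y.
rewrite [LHS](frame_exp x F) exy nxy [in RHS](frame_exp y F) /d.
by apply/rowP => i; rewrite !mxE; ring.
Qed.

Lemma par_unit u v t : dot u u = 1 -> dot v v = 1 -> v = t *: u -> par u v.
Proof.
move=> uu vv vE; move: vv; rewrite vE !dotL uu mulr1 => /eqP.
rewrite -expr2 sqrf_eq1 => /orP[] /eqP ->; first by left; rewrite scale1r.
by right; rewrite scaleN1r.
Qed.

Lemma par_frame u e v : unit_frame u e -> dot v v = 1 ->
  dot e v = 0 -> dot (cross u e) v = 0 -> par u v.
Proof.
move=> F vv ev nv; have [uu _ _] := F; apply: (@par_unit u v (dot u v)) => //.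
by rewrite {1}(frame_exp v F) ev nv !scale0r !addr0.
Qed.

Lemma par_dot0 u v n : par u v -> dot n u = 0 -> dot n v = 0.
Proof. by case=> ->; rewrite ?dotNr => ->; rewrite ?oppr0. Qed.

Lemma par_scale u v t : par u v -> exists t', t *: u = t' *: v.
Proof. by case=> ->; [exists t|exists (- t); rewrite scalerN scaleNr opprK]. Qed.

Lemma par_sym u v : par u v -> par v u.
Proof. by case=> ->; [left|right; rewrite opprK]. Qed.

Lemma par_trans u v w : par u v -> par v w -> par u w.
Proof. by case=> -> [] ->; rewrite ?opprK; [left|right|right|left]. Qed.

End Frame.

Section Rigidity.
Variables (R : realType) (V : 'rV[R]_3 -> 'rV[R]_3).
Hypothesis hV : line_fibration V.
Implicit Types (u v e n k x y p q w : 'rV[R]_3).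

Lemma V_cont : continuous V. Proof. by case: hV. Qed.

Lemma V_unit p : dot (V p) (V p) = 1.
Proof.
case: hV => _ /(_ p) h _ _.
by rewrite -(sqr_sqrtr (dot_ge0 (V p))) -/(enorm _) h expr1n.
Qed.

(** The curves [t |-> p + t V(p)] have constant velocity [V p], and being
    integral curves they have velocity [V] at each of their points. *)
Lemma V_flow p t : V (p + t *: V p) = V p.
Proof.
case: hV => _ _ /(_ p t) h _.
have h2 : is_derive t (1:R) (fun s : R => p + s *: V p) (V p).
  have E : (fun h0 : R => h0^-1 *: ((fun s : R => p + s *: V p) (h0 *: (1:R) + t)
     - (p + t *: V p))) @ 0^' --> V p.
    apply: (@cvg_trans _ (cst (V p) @ (0 : R)^')); last exact: cvg_cst.
    apply: near_eq_cvg; near=> h0; rewrite /cst.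
    have h00 : h0 != 0 by near: h0; exact: nbhs_dnbhs_neq.
    by apply/rowP => i; rewrite (_ : h0 *: (1 : R) = h0) ?[LHS]mulr1 // !mxE; field.
  apply: DeriveDef; first by apply/cvg_ex; exists (V p); exact: E.
  exact: cvg_lim E.
by rewrite -(@derive_val _ _ _ _ _ _ _ h) (@derive_val _ _ _ _ _ _ _ h2).
Unshelve. all: by end_near.
Qed.

Lemma V_meet p q s t : p + s *: V p = q + t *: V q -> V p = V q.
Proof. by move=> h; rewrite -(V_flow p s) h V_flow. Qed.

Lemma V_par_flow u p t : par u (V p) -> V (p + t *: u) = V p.
Proof. by move=> h; have [t' ->] := par_scale t h; rewrite V_flow. Qed.

Lemma V_meet_par u p q s t : par u (V q) -> p + s *: V p = q + t *: u -> V p = V q.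
Proof. by move=> h; have [t' ->] := par_scale t h; exact: V_meet. Qed.

End Rigidity.

(** * The tube of fibers through a gap *)

Section Gap.
Variables (R : realType) (V : 'rV[R]_3 -> 'rV[R]_3).
Hypothesis hV : line_fibration V.
Implicit Types (u v e n k b x y p q w : 'rV[R]_3) (t s : R).

(** The strip is cut out of the plane [cross u e . p = z0] by
    [y1 < e . p < y2]. Its edges are fibers parallel to [u], and transversality
    to the plane on the open strip says that no fiber there is parallel to
    [u]. *)
Definition gap u e (z0 y1 y2 : R) :=
  [/\ unit_frame u e, y1 < y2,
      exists b, [/\ dot (cross u e) b = z0, dot e b = y1 & par u (V b)],
      exists b, [/\ dot (cross u e) b = z0, dot e b = y2 & par u (V b)] &
      forall p, dot (cross u e) p = z0 -> y1 < dot e p < y2 ->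
        dot (cross u e) (V p) != 0].

(** The points whose fiber crosses the strip. The crossing point of the fiber
    of [w] has [e]-coordinate
    [e . w - (n . w - z0) (e . V w) / (n . V w)], where [n = cross u e];
    multiplying the conditions that it lies between [y1] and [y2] by
    [(n . V w)^2] avoids the division, makes the set visibly open, and builds in
    transversality. *)
Definition tube u e (z0 y1 y2 : R) : set 'rV[R]_3 := [set w |
  0 < (dot e w - y1) * dot (cross u e) (V w) ^+ 2 -
      (dot (cross u e) w - z0) * dot e (V w) * dot (cross u e) (V w) /\
  0 < (y2 - dot e w) * dot (cross u e) (V w) ^+ 2 +
      (dot (cross u e) w - z0) * dot e (V w) * dot (cross u e) (V w)].

Lemma cont_dotc n : continuous (fun w => dot n w).
Proof. by apply: cont_dot; [exact: cont_const|exact: cont_id]. Qed.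

Lemma cont_dotV n : continuous (fun w => dot n (V w)).
Proof. by apply: cont_dot; [exact: cont_const|exact: V_cont]. Qed.

Lemma tube_cont u e (z0 y s : R) :
  continuous (fun w => s * (dot e w - y) * dot (cross u e) (V w) ^+ 2 -
      s * ((dot (cross u e) w - z0) * dot e (V w) * dot (cross u e) (V w))).
Proof.
have c1 : continuous (fun w => dot e w - y).
  by apply: cont_addR; [exact: cont_dotc|exact: cont_const].
have c2 : continuous (fun w => dot (cross u e) w - z0).
  by apply: cont_addR; [exact: cont_dotc|exact: cont_const].
have cs : continuous (fun _ : 'rV[R]_3 => s) by exact: cont_const.
apply: cont_addR; first by do !apply: cont_mulR => //; exact: cont_dotV.
by apply: cont_oppR; do !apply: cont_mulR => //; exact: cont_dotV.
Qed.

Lemma tubeE u e (z0 y1 y2 : R) : tube u e z0 y1 y2 =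
  [set w | 0 < 1 * (dot e w - y1) * dot (cross u e) (V w) ^+ 2 -
      1 * ((dot (cross u e) w - z0) * dot e (V w) * dot (cross u e) (V w))] `&`
  [set w | 0 < -1 * (dot e w - y2) * dot (cross u e) (V w) ^+ 2 -
      -1 * ((dot (cross u e) w - z0) * dot e (V w) * dot (cross u e) (V w))].
Proof.
apply/seteqP; split => w [] /= h1 h2; split; rewrite /=; lra.
Qed.

Lemma tube_open u e (z0 y1 y2 : R) : open (tube u e z0 y1 y2).
Proof.
by rewrite tubeE; apply: openI; apply: open_pos; exact: tube_cont.
Qed.

Lemma tube_transverse u e (z0 y1 y2 : R) w : tube u e z0 y1 y2 w ->
  dot (cross u e) (V w) != 0.
Proof. by move=> [h _]; apply/eqP => h0; move: h; rewrite h0 expr0n !mulr0 subr0 ltxx. Qed.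

Lemma tube_flow u e (z0 y1 y2 : R) w t :
  tube u e z0 y1 y2 w -> tube u e z0 y1 y2 (w + t *: V w).
Proof.
by rewrite /tube /= V_flow // !dotL => -[h1 h2]; split;
  [move: h1|move: h2]; congr (_ < _); ring.
Qed.

Lemma tube_flowE u e (z0 y1 y2 : R) w t :
  tube u e z0 y1 y2 (w + t *: V w) -> tube u e z0 y1 y2 w.
Proof.
move=> /(@tube_flow _ _ _ _ _ _ (- t)).
by rewrite V_flow // scaleNr addrK.
Qed.

(** In a plane that contains a fiber of direction [u], a fiber of another
    direction would cross it. *)
Lemma plane_par u e b q : unit_frame u e ->
  dot (cross u e) b = dot (cross u e) q -> par u (V b) ->
  dot (cross u e) (V q) = 0 -> par u (V q).
Proof.
move=> F bq Vb nq.
have [e0|e0] := eqVneq (dot e (V q)) 0.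
  exact: (par_frame F (V_unit hV q)).
set t := (dot e b - dot e q) / dot e (V q).
apply: (par_trans Vb); left.
apply: (V_meet_par hV Vb (s := t)); apply: (frame_eq F).
  by rewrite !dotL /t; field.
by rewrite !dotL nq bq mulr0 addr0.
Qed.

Section WithGap.
Variables (u e : 'rV[R]_3) (z0 y1 y2 : R).
Hypothesis hG : gap u e z0 y1 y2.
Let n := cross u e.
Let W := tube u e z0 y1 y2.

Lemma tube_in_plane p : dot n p = z0 -> W p <-> y1 < dot e p < y2.
Proof.
move=> pz; split.
  rewrite /W /tube /= -/n pz subrr !mul0r subr0 addr0 => -[h1 h2].
  have n2 := sqr_ge0 (dot n (V p)).
  by apply/andP; split; nra.
move=> py; have [_ _ _ _ /(_ _ pz py) hn] := hG; case/andP: py => p1 p2.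
have n2 : 0 < dot n (V p) ^+ 2 by rewrite exprn_even_gt0.
rewrite /W /tube /= -/n pz subrr !mul0r subr0 addr0.
by split; apply: mulr_gt0 => //; rewrite subr_gt0.
Qed.

(** If the fiber through [w] is transverse to the plane, it meets the plane in
    the closed strip, hence on an edge. If it is not, then it stays at constant
    height; the fibers of nearby points of the tube meet the plane at bounded
    [e]-coordinate although they become horizontal, so [V w] has no
    [e]-component either. *)
Lemma tube_frontier w : closure W w -> ~ W w -> par u (V w).
Proof.
move=> clw Ww; have [F y12 [b1 [b1z b1y b1V]] [b2 [b2z b2y b2V]] _] := hG.
have [uu ee ue] := F.
have h1 := closure_nneg (@tube_cont u e z0 y1 1) _ clw.
have h2 := closure_nneg (@tube_cont u e z0 y2 (-1)) _ clw.
have {}h1 : 0 <= (dot e w - y1) * dot n (V w) ^+ 2 -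
      (dot n w - z0) * dot e (V w) * dot n (V w).
  by rewrite -[X in 0 <= X]mul1r mulrBr mulrA; apply: h1 => p [] h _; rewrite !mul1r ltW.
have {}h2 : 0 <= (y2 - dot e w) * dot n (V w) ^+ 2 +
      (dot n w - z0) * dot e (V w) * dot n (V w).
  suff : 0 <= -1 * (dot e w - y2) * dot n (V w) ^+ 2 -
      -1 * ((dot n w - z0) * dot e (V w) * dot n (V w)) by lra.
  by apply: h2 => p [] _; rewrite -/n => /ltW h; lra.
have [n0|n0] := eqVneq (dot n (V w)) 0.
  have [z|z] := eqVneq (dot n w) z0; first by apply: (plane_par F _ b1V n0); rewrite b1z -/n z.
  suff e0 : dot e (V w) = 0 by apply: (par_frame F) => //; exact: V_unit.
  (* on the tube, |n.w - z0| |e.V w| <= (|e.w| + B) |n.V w|; [c3] is about a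
     smooth form of this inequality, which passes to the limit *)
  pose B : R := 1 + `|y1| + `|y2|.
  have c3 : continuous (fun w => (dot e w ^+ 2 + B ^+ 2) * dot n (V w) ^+ 2 *+ 4 -
       (dot n w - z0) ^+ 2 * dot e (V w) ^+ 2).
    have c1 : continuous (fun w => dot e w) by exact: cont_dotc.
    have c2 : continuous (fun w => dot n w - z0).
      by apply: cont_addR; [exact: cont_dotc|exact: cont_const].
    apply: cont_addR; last by apply: cont_oppR; do !apply: cont_mulR => //; exact: cont_dotV.
    rewrite (_ : (fun w => _) = (fun w => 4 * ((dot e w ^+ 2 + B ^+ 2) * dot n (V w) ^+ 2)));
      last by apply/funext => x; rewrite mulr_natl.
    apply: cont_mulR; first exact: cont_const.
    apply: cont_mulR; last by apply: cont_mulR; exact: cont_dotV.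
    by apply: cont_addR; [exact: cont_mulR|exact: cont_const].
  have := closure_nneg c3 _ clw.
  rewrite n0 expr0n mulr0 mul0rn sub0r => h3.
  have {}h3 : (dot n w - z0) ^+ 2 * dot e (V w) ^+ 2 <= 0.
    rewrite -oppr_ge0; apply: h3 => p [].
    rewrite -/n; move: (dot n (V p)) (dot e (V p)) (dot n p - z0) (dot e p) => a b c d g1 g2.
    have a0 : a != 0 by apply/eqP => a0; move: g1; rewrite a0 expr0n !mulr0 subr0 ltxx.
    have a2 : 0 < a ^+ 2 by rewrite exprn_even_gt0.
    (* [g] is the [e]-coordinate at which the fiber of [p] crosses the plane *)
    have [g Eg] : exists g, c * b = (d - g) * a by exists (d - c * b / a); field.
    have gy1 : y1 < g.
      rewrite -subr_gt0 -(pmulr_lgt0 _ a2).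
      by rewrite (_ : _ * _ = (d - y1) * a ^+ 2 - c * b * a) // Eg; ring.
    have gy2 : g < y2.
      rewrite -subr_gt0 -(pmulr_lgt0 _ a2).
      by rewrite (_ : _ * _ = (y2 - d) * a ^+ 2 + c * b * a) // Eg; ring.
    have gB : g ^+ 2 <= B ^+ 2.
      rewrite -[g ^+ 2]real_normK ?num_real // ler_sqr ?nnegrE ?addr_ge0 //.
      have := ler_norm y2; have := ler_norm (- y1); rewrite normrN /B => ? ?.
      have := normr_ge0 y1; have := normr_ge0 y2 => ? ?.
      by rewrite ler_norml; apply/andP; split; lra.
    rewrite -exprMn Eg exprMn -mulrnAl -mulrBl.
    apply: mulr_ge0; last exact: ltW.
    by rewrite -mulr_natl; nra.
  have z2 : 0 < (dot n w - z0) ^+ 2 by rewrite exprn_even_gt0 //= subr_eq0.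
  by apply/eqP; rewrite -sqrf_eq0 eq_le sqr_ge0 andbT -(pmulr_rle0 _ z2).
pose t := - (dot n w - z0) / dot n (V w).
have zt : dot n (w + t *: V w) = z0 by rewrite !dotL /t; field.
suff [b [bz by_ bV]] : exists b, [/\ dot n b = z0, dot e b = dot e (w + t *: V w) & par u (V b)].
  apply: (par_trans bV); left.
  by apply: (V_meet_par hV bV (s := t)); apply: (frame_eq F); rewrite // -/n zt bz.
have n2 : 0 < dot n (V w) ^+ 2 by rewrite exprn_even_gt0.
have E1 : (dot e (w + t *: V w) - y1) * dot n (V w) ^+ 2 = (dot e w - y1) * dot n (V w) ^+ 2 -
      (dot n w - z0) * dot e (V w) * dot n (V w) by rewrite !dotL /t; field.
have E2 : (y2 - dot e (w + t *: V w)) * dot n (V w) ^+ 2 = (y2 - dot e w) * dot n (V w) ^+ 2 +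
      (dot n w - z0) * dot e (V w) * dot n (V w) by rewrite !dotL /t; field.
move: h1 h2; rewrite -E1 -E2 !pmulr_lge0 // !subr_ge0 => h1 h2.
have [<-|d1] := eqVneq y1 (dot e (w + t *: V w)); first by exists b1.
have [->|d2] := eqVneq (dot e (w + t *: V w)) y2; first by exists b2.
case: Ww; rewrite /W /tube /= -/n -E1 -E2.
by split; rewrite pmulr_lgt0 // subr_gt0 lt_neqAle ?d1 ?d2.
Qed.

Lemma tube_not_par w : W w -> ~ par u (V w).
Proof.
move=> /tube_transverse /eqP h p; apply: h; apply: (par_dot0 p).
by rewrite dotC cross_dotl.
Qed.

(** A line parallel to [u] that left the tube would meet its frontier, and
    would then itself be a fiber by [tube_frontier]; but the fibers of the tube
    are not parallel to [u]. *)
Lemma tube_translate w t : W w -> W (w + t *: u).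
Proof.
move=> Ww.
rewrite -[t]mul1r.
apply: (@path_open_closed R _ W (fun s => w + (s * t) *: u)).
- apply: cont_add; first exact: cont_const.
  by apply: cont_scale; [apply: cont_mulR; [exact: cont_id|exact: cont_const]|exact: cont_const].
- exact: tube_open.
- by rewrite mul0r scale0r addr0.
- move=> s _ cl; apply: contrapT => nW.
  have p := tube_frontier cl nW.
  apply: (tube_not_par Ww).
  by rewrite -(addrK ((s * t) *: u) w) -scaleNr V_par_flow.
Qed.

End WithGap.
End Gap.

(** * Coplanar directions force a 1-parameter fibration *)

Section Slab.
Variables (R : realType) (V : 'rV[R]_3 -> 'rV[R]_3).
Hypothesis hV : line_fibration V.
Implicit Types (u v e n k b x y p q w : 'rV[R]_3) (t s : R).

Lemma closure_dir (A : set 'rV[R]_3) w e (d : R) : 0 < d ->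
  (forall s, 0 < s < d -> A (w + s *: e)) -> closure A w.
Proof.
move=> d0 Ad B nB.
have c : (fun s : R => w + s *: e) @ (0:R)^'+ --> w.
  apply: cvg_at_right_filter.
  have -> : w = w + (0:R) *: e by rewrite scale0r addr0.
  rewrite {1}scale0r addr0.
  exact: (cont_add (@cont_const _ _ w) (cont_scale (@cont_id _) (@cont_const _ _ e))).
have /filter_ex [s [/Ad Aw Bw]] : \forall s \near (0:R)^'+, (0 < s < d) /\ B (w + s *: e).
  near=> s; split; last by near: s; exact: c.
  apply/andP; split; near: s; first exact: nbhs_right_gt.
  exact: nbhs_right_lt.
by exists (w + s *: e).
Unshelve. all: by end_near.
Qed.

(** A fiber transverse to [k] would cross the plane, where [V] is tangent to
    it. So all fibers are parallel to this one plane. *)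
Lemma tangent_plane_one_parameter k (c : R) : k != 0 ->
  (forall p, dot k p = c -> dot k (V p) = 0) -> one_parameter V.
Proof.
move=> k0 h; exists k => // p; exists (dot k p) => _ [t _ <-].
rewrite /plane /= !dotL.
have [->|kV] := eqVneq (dot k (V p)) 0; first by rewrite mulr0 addr0.
have := h (p + ((c - dot k p) / dot k (V p)) *: V p).
by rewrite V_flow // !dotL => H; rewrite H ?mulr0 ?addr0 //; field.
Qed.

Lemma dot_frame u e k x : unit_frame u e -> dot k u = 0 ->
  dot k x = dot e x * dot k e + dot (cross u e) x * dot k (cross u e).
Proof.
by move=> F ku; rewrite {1}(frame_exp x F) !dotL ku; ring.
Qed.

(** If the directions on the strip are orthogonal to [k], the tube lies on one
    side of the plane through the first edge orthogonal to [k], and this plane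
    is in its frontier. *)
Lemma coplanar_strip_one_parameter u e (z0 y1 y2 : R) k : gap V u e z0 y1 y2 ->
  dot k u = 0 -> dot k e != 0 ->
  (forall p, dot (cross u e) p = z0 -> y1 < dot e p < y2 -> dot k (V p) = 0) ->
  one_parameter V.
Proof.
move=> hG ku ke kV; have [F y12 [b [bz by_ bV]] _ _] := hG.
have [uu ee ue] := F.
have k0 : k != 0 by apply: contraNneq ke => ->; rewrite dot0l.
have nn : dot (cross u e) (cross u e) = 1 by rewrite crossL uu ee ue; ring.
have ne : dot (cross u e) e = 0 by rewrite dotC cross_dotr.
apply: (@tangent_plane_one_parameter k (dot k b)) => // w kw.
suff pw : par u (V w) by exact: (par_dot0 pw).
apply: (tube_frontier hV hG).
  apply: (@closure_dir _ _ e (y2 - y1)); first by rewrite subr_gt0.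
  move=> s /andP[s0 s1].
  pose z := dot (cross u e) w - z0.
  (* the point of the strip above which [w + s e] lies, along a direction orthogonal to [k] *)
  pose p := w + s *: e - z *: (cross u e - (dot k (cross u e) / dot k e) *: e).
  have pz : dot (cross u e) p = z0 by rewrite /p !dotL nn ne /z; ring.
  have kp : dot k p = dot k b + s * dot k e by rewrite /p !dotL kw; field.
  have py : dot e p = y1 + s.
    move: kp; rewrite (dot_frame p F ku) (dot_frame b F ku) pz bz by_ => h.
    by apply: (mulIf ke); rewrite mulrDl; lra.
  clearbody p; have ps : y1 < dot e p < y2 by rewrite py; apply/andP; split; lra.
  have Wp : tube V u e z0 y1 y2 p by apply/(tube_in_plane hG).
  have nV := tube_transverse Wp.
  pose t := z / dot (cross u e) (V p).
  have nE : dot (cross u e) (w + s *: e) = dot (cross u e) (p + t *: V p).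
    rewrite !dotDr !dotZr pz ne /t /z; field.
    exact: nV.
  have kE : dot k (w + s *: e) = dot k (p + t *: V p).
    by rewrite !dotDr !dotZr (kV p) // kp kw; ring.
  move: (kE); rewrite (dot_frame (w + _) F ku) (dot_frame (p + _) F ku) nE => /addIr /(mulIf ke) eE.
  rewrite (frame_eq F eE nE); apply: (tube_translate hV hG).
  exact: tube_flow.
move=> Ww; have nV := tube_transverse Ww.
pose t := - (dot (cross u e) w - z0) / dot (cross u e) (V w).
have qz : dot (cross u e) (w + t *: V w) = z0 by rewrite !dotL /t; field.
have Wq := tube_flow hV t Ww.
have qy := Wq; move/(tube_in_plane hG qz): qy => qy.
have := kV _ qz qy; rewrite V_flow // => kVw.
have : dot k (w + t *: V w) = dot k b by rewrite !dotL kVw kw; ring.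
rewrite (dot_frame (w + _) F ku) (dot_frame b F ku) qz bz by_.
move=> /addIr /(mulIf ke) E; move: qy; rewrite E ltxx //.
Qed.

(** The tubes of two such gaps are disjoint, since each meets the plane in its
    own strip. Both are invariant along [u], so the projections along [u] of
    their fibers are disjoint lines of a plane, hence parallel. *)
Lemma two_gaps_one_parameter u e (z0 y1 y2 y3 y4 : R) :
  gap V u e z0 y1 y2 -> gap V u e z0 y3 y4 -> y2 <= y3 -> one_parameter V.
Proof.
move=> g1 g2 y23.
have [F y12 _ _ n1] := g1; have [_ y34 _ _ n2] := g2.
have [uu ee ue] := F; pose n := cross u e.
have nn : dot n n = 1 by rewrite crossL uu ee ue; ring.
have ne : dot n e = 0 by rewrite dotC cross_dotr.
have en : dot e n = 0 by rewrite cross_dotr.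
pose q := z0 *: n + ((y3 + y4) / 2) *: e.
have qz : dot n q = z0 by rewrite /q !dotL nn ne; ring.
have qy : y3 < dot e q < y4 by rewrite /q !dotL en ee; apply/andP; split; lra.
have nq := n2 _ qz qy; clearbody q.
pose k := dot n (V q) *: e - dot e (V q) *: n.
apply: (coplanar_strip_one_parameter g1 (k := k)).
- by rewrite /k !dotL (dotC e u) ue (dotC n u) cross_dotl; ring.
- by rewrite /k !dotL ee ne mulr0 subr0 mulr1.
move=> p pz py; have np := n1 _ pz py.
rewrite /k !dotL; apply/eqP/negPn/negP => h.
have Wp : tube V u e z0 y1 y2 p by apply/(tube_in_plane g1).
(* otherwise the projected lines cross: [d] is the determinant of their directions *)
pose d := dot n (V q) * dot e (V p) - dot e (V q) * dot n (V p).
have d0 : d != 0 by rewrite /d; move: h; congr (~~ (_ == _)); ring.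
pose s := (dot e q - dot e p) / d.
have : tube V u e z0 y1 y2 q.
  apply: (tube_flowE hV (t := s * dot n (V p))).
  rewrite (@frame_eq _ u e (q + _) (p + (s * dot n (V q)) *: V p) F).
  - by apply: (tube_translate hV g1); exact: tube_flow.
  - have sd : s * d = dot e q - dot e p by rewrite /s; field.
    by rewrite !dotL -[dot e q](subrK (dot e p)) -sd /d; ring.
  - by rewrite -/n !dotL pz qz; ring.
by move/(tube_in_plane g1 qz); lra.
Qed.

End Slab.

(** * Gaps whose two edges have the same direction *)

Section SameSign.
Variables (R : realType) (V : 'rV[R]_3 -> 'rV[R]_3).
Hypothesis hV : line_fibration V.
Implicit Types (u v e n k b x y p q w : 'rV[R]_3) (t s : R).

Lemma last_zero (h : R -> R) (a b : R) : continuous h -> a <= b ->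
  0 < h a -> h b < 0 ->
  exists s, [/\ a < s, s < b, h s = 0 & forall t, s < t <= b -> h t < 0].
Proof.
move=> ch ab ha hb.
have [||s [as_ sb hs H]] := last_point_in (closed_nneg ch) ab.
- by rewrite /= ltW.
- by rewrite /= leNgt hb.
have hs0 : h s = 0.
  have [|c /andP[sc cb] hc] := ivt0 ch (ltW sb); first by move: hs; rewrite /=; nra.
  have [->//|nsc] := eqVneq s c.
  by case: (H c); rewrite /= ?hc // lt_neqAle nsc sc cb.
exists s; split => //.
  by rewrite lt_neqAle as_ andbT; apply/eqP => e; move: ha; rewrite e hs0 ltxx.
by move=> t /H /= /negP; rewrite -ltNge.
Qed.

Lemma first_zero (h : R -> R) (a b : R) : continuous h -> a <= b ->
  h a < 0 -> 0 < h b ->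
  exists s, [/\ a < s, s < b, h s = 0 & forall t, a <= t < s -> h t < 0].
Proof.
move=> ch ab ha hb.
have cN : continuous (fun x : R => h (- x)).
  by apply: (@cont_comp _ _ _ (fun x : R => - x) h) => //; apply: cont_oppR; exact: cont_id.
have [|||s [as_ sb hs H]] := last_zero cN (a := - b) (b := - a).
- by rewrite lerN2.
- by rewrite opprK.
- by rewrite opprK.
exists (- s); split => //; try lra.
move=> t /andP[t1 t2]; rewrite -[t]opprK; apply: H; apply/andP; split; lra.
Qed.

(** Gram-Schmidt. *)
Lemma frame_complete v e : dot v v = 1 -> dot e e = 1 -> ~ par v e ->
  exists2 r : R, 0 < r & unit_frame v (r *: (e - dot e v *: v)).
Proof.
move=> vv ee np.
have d0 : 0 < 1 - dot e v ^+ 2.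
  rewrite lt_neqAle subr_ge0; have := cauchy_dot e v; rewrite vv ee mulr1 => ->.
  rewrite andbT eq_sym subr_eq0; apply/eqP => h; apply: np.
  apply: (@par_unit _ v e (dot e v)) => //.
  apply/eqP; rewrite -subr_eq0 -dot_eq0 !dotL vv ee (dotC v e).
  by apply/eqP; rewrite -[1]/(1:R) {1}h; ring.
exists (Num.sqrt (1 - dot e v ^+ 2))^-1; first by rewrite invr_gt0 sqrtr_gt0.
split => //; last by rewrite !dotL vv (dotC v e); ring.
rewrite !dotL vv ee (dotC v e); set r := Num.sqrt _.
have r2 : r ^+ 2 = 1 - dot e v ^+ 2 by rewrite sqr_sqrtr // ltW.
have r0 : r != 0 by rewrite gt_eqF // sqrtr_gt0.
rewrite (_ : _ * _ = r^-1 ^+ 2 * (1 - dot e v ^+ 2)); last by ring.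
by rewrite -r2; field.
Qed.

(** Along a segment across the strip, the slope [(u . V) / (n . V)] tends to
    the same infinity at both ends, so it takes some value [rho] at two points
    [ya] and [yb], with no such value in between. The fibers through these two
    points lie in a common plane and do not cross; they are therefore parallel,
    of direction [v], and bound a gap of direction [v]. Its tube is contained in
    the tube of the first gap. If [q] is in the new strip, the plane spanned by
    [v] and [V q] at [q] is contained in the new tube, hence meets the first
    plane inside the first strip: along a line parallel to [u]. So all [V q] are
    orthogonal to the same vector [k]. *)
Lemma same_direction_gap_one_parameter u e (z0 y1 y2 : R) b1 b2 : gap V u e z0 y1 y2 ->
  dot (cross u e) b1 = z0 -> dot e b1 = y1 -> V b1 = u ->
  dot (cross u e) b2 = z0 -> dot e b2 = y2 -> V b2 = u ->
  one_parameter V.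
Proof.
move=> hG b1z b1y b1V b2z b2y b2V.
have [F y12 _ _ nV] := hG; have [uu ee ue] := F.
set n := cross u e in b1z b2z nV.
have nn : dot n n = 1 by rewrite crossL uu ee ue; ring.
have ne : dot n e = 0 by rewrite dotC cross_dotr.
have en : dot e n = 0 by rewrite cross_dotr.
have un : dot u n = 0 by rewrite cross_dotl.
have nu : dot n u = 0 by rewrite dotC.
have eu : dot e u = 0 by rewrite dotC.
pose P (s : R) : 'rV[R]_3 := s *: e + z0 *: n.
have nP s : dot n (P s) = z0 by rewrite !dotL ne nn; ring.
have eP s : dot e (P s) = s by rewrite !dotL ee en; ring.
have uP s : dot u (P s) = 0 by rewrite !dotL ue un; ring.
have cP : continuous P.
  apply: cont_add; last exact: cont_const.
  by apply: cont_scale; [exact: cont_id|exact: cont_const].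
clearbody P.
have VP1 : V (P y1) = u.
  rewrite (@frame_eq _ u e (P y1) b1 F) ?eP ?nP //.
  by rewrite V_par_flow // b1V; left.
have VP2 : V (P y2) = u.
  rewrite (@frame_eq _ u e (P y2) b2 F) ?eP ?nP //.
  by rewrite V_par_flow // b2V; left.
have cdV x : continuous (fun s => dot x (V (P s))).
  by apply: (@cont_comp _ _ _ P (fun w => dot x (V w))) => //; exact: cont_dotV.
pose yc := (y1 + y2) / 2.
have yc1 : y1 < yc by rewrite /yc; lra.
have yc2 : yc < y2 by rewrite /yc; lra.
clearbody yc.
have nc : dot n (V (P yc)) != 0 by apply: nV; rewrite ?nP ?eP ?yc1.
(* a level chosen beyond the slope at the middle of the strip, so that the
   function [h] below, which vanishes where the slope is [rho], is negative in
   the middle while it equals 1 at both edges *)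
pose rho := (dot u (V (P yc)) + 1) / dot n (V (P yc)).
pose h s := dot u (V (P s)) - rho * dot n (V (P s)).
have ch : continuous h.
  apply: cont_addR => //; apply: cont_oppR; apply: cont_mulR => //; exact: cont_const.
have h1 : 0 < h y1 by rewrite /h VP1 uu nu mulr0 subr0.
have h2 : 0 < h y2 by rewrite /h VP2 uu nu mulr0 subr0.
have hc : h yc < 0.
  rewrite (_ : h yc = -1) ?ltrN10 // /h /rho; field; exact: nc.
have [ya [ya1 yac hya Hya]] := last_zero ch (ltW yc1) h1 hc.
have [yb [ybc yb2 hyb Hyb]] := first_zero ch (ltW yc2) hc h2.
have hneg s : ya < s < yb -> h s < 0.
  move=> /andP[s1 s2]; have [sc|sc] := leP s yc; first by apply: Hya; rewrite s1.
  by apply: Hyb; rewrite (ltW sc).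
have nPs s : y1 < s < y2 -> dot n (V (P s)) != 0.
  by move=> hs; apply: nV; rewrite ?nP ?eP.
pose va := V (P ya); pose vb := V (P yb).
have na : dot n va != 0 by apply: nPs; apply/andP; split; lra.
have nb : dot n vb != 0 by apply: nPs; apply/andP; split; lra.
have ua : dot u va = rho * dot n va by apply/eqP; rewrite -subr_eq0; apply/eqP; exact: hya.
have ub : dot u vb = rho * dot n vb by apply/eqP; rewrite -subr_eq0; apply/eqP; exact: hyb.
have vaa : dot va va = 1 by exact: V_unit.
have vbb : dot vb vb = 1 by exact: V_unit.
(* the two fibers lie in one plane and would cross if their slopes differed *)
have dab : dot n va * dot e vb = dot n vb * dot e va.
  apply/eqP; rewrite -subr_eq0; apply/negPn/negP; set d := _ - _ => d0.
  pose s := - (yb - ya) / d.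
  have sd : s * d = ya - yb by rewrite /s; field.
  have : P ya + (s * dot n vb) *: va = P yb + (s * dot n va) *: vb.
    rewrite (@frame_eq _ u e (P ya + _) (P yb + (s * dot n va) *: vb) F).
    - rewrite !dotL !uP ua ub (_ : _ - _ = 0); last by ring.
      by rewrite scale0r addr0.
    - rewrite !dotL !eP -[ya](subrK yb) -sd /d; ring.
    - by rewrite -/n !dotL !nP; ring.
  move/(V_meet hV); rewrite -/va -/vb => E.
  by move: d0; rewrite /d E subrr eqxx.
have vabE : vb = va.
  have : par va vb.
    apply: (@par_unit _ va vb (dot n vb / dot n va)) => //.
    rewrite [LHS](frame_exp vb F) {2}(frame_exp va F) -/n.
    have -> : dot e vb = dot n vb / dot n va * dot e va.
      by apply: (mulfI na); rewrite dab; field.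
    rewrite ua ub; apply/rowP => i; rewrite !mxE; field.
    exact: na.
  case=> // E.
  have [||c /andP[ac cb] nc0] := @ivt0 _ (fun s => dot n (V (P s))) ya yb (cdV n).
  - lra.
  - by rewrite -/va -/vb E dotNr mulrN oppr_le0 -expr2 sqr_ge0.
  by have := nPs c; rewrite nc0 eqxx => H; have : false by apply: H; apply/andP; split; lra.
have npe : ~ par va e.
  by move=> /par_sym pe; move: na; rewrite (par_dot0 pe ne) eqxx.
have [r r0 Fv] := frame_complete vaa ee npe.
set ev := r *: _ in Fv.
have eva : dot ev va = 0 by case: Fv => _ _; rewrite dotC.
pose nv := cross va ev.
have nve : dot nv e = 0.
  rewrite /nv /ev; have <- : r * dot (cross va e) e = 0 by rewrite dotC cross_dotr mulr0.
  dring.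
have eve : 0 < dot ev e.
  have [_ h11 _] := Fv; have : dot ev ev = r * dot ev e.
    rewrite {2}/ev dotZr dotDr dotNr dotZr eva; ring.
  by rewrite h11 => E; rewrite -(pmulr_rgt0 _ r0) -E ltr01.
pose za := dot nv (P ya).
have Pab s t : P s = P t + (s - t) *: e.
  rewrite (@frame_eq _ u e (P s) (P t + (s - t) *: e) F).
  - have -> : dot u (P s) - dot u (P t + (s - t) *: e) = 0 by rewrite !dotL !uP ue; ring.
    by rewrite scale0r addr0.
  - by rewrite !dotL !eP ee; ring.
  - by rewrite -/n !dotL !nP ne; ring.
have nvP s : dot nv (P s) = za by rewrite (Pab s ya) !dotL nve mulr0 addr0.
have evP s t : dot ev (P s) = dot ev (P t) + (s - t) * dot ev e by rewrite (Pab s t) !dotL.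
have strip p : dot nv p = za -> dot ev (P ya) < dot ev p < dot ev (P yb) ->
    exists s t, ya < s < yb /\ p = P s + t *: va.
  move=> pz /andP[p1 p2].
  pose s := ya + (dot ev p - dot ev (P ya)) / dot ev e.
  have sE : (s - ya) * dot ev e = dot ev p - dot ev (P ya).
    by rewrite /s; field; rewrite gt_eqF.
  have evs : dot ev (P s) = dot ev p by rewrite (evP s ya) sE; ring.
  exists s, (dot va p - dot va (P s)); split; last first.
    by apply: (frame_eq Fv); rewrite -/nv ?nvP ?evs.
  by apply/andP; split; rewrite -(ltr_pM2r eve) -subr_gt0 -mulrBl;
   [have := evP s ya|have := evP yb s]; lra.
have hGv : gap V va ev za (dot ev (P ya)) (dot ev (P yb)).
  split => //.
  - by rewrite (evP yb ya) ltrDl mulr_gt0 // subr_gt0; lra.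
  - by exists (P ya); split => //; left.
  - by exists (P yb); split => //; left.
  move=> p pz py; have [s [t [sab pE]]] := strip p pz py.
  apply/eqP => n0.
  have pv : par va (V p) by apply: (@plane_par _ V hV va ev (P ya) p Fv) => //; left.
  have VpE : V (P s) = V p.
    have -> : P s = p + (- t) *: va by rewrite pE scaleNr addrK.
    by rewrite V_par_flow.
  have := hneg s sab; rewrite /h VpE.
  by case: pv => ->; rewrite ?dotNr ua (_ : _ - _ = 0) ?ltxx //; ring.
(* the fibers through [P c], for [c] between [ya] and [yb], reach by the
   intermediate value theorem every line parallel to [u] between the fibers of
   [P ya] and [P yb] *)
have sub_strip p : dot nv p = za -> dot ev (P ya) < dot ev p < dot ev (P yb) ->
    tube V u e z0 y1 y2 p.
  move=> pz py; have [s [t [/andP[s1 s2] pE]]] := strip p pz py.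
  pose f c := (c - s - t * dot e va) * dot n (V (P c)) + t * dot n va * dot e (V (P c)).
  have cf : continuous f.
    apply: cont_addR.
      apply: cont_mulR => //; do 2!(apply: cont_addR; last exact: cont_const).
      exact: cont_id.
    by apply: cont_mulR => //; exact: cont_const.
  have fa : f ya = (ya - s) * dot n va by rewrite /f -/va; ring.
  have fb : f yb = (yb - s) * dot n va by rewrite /f -/vb vabE; ring.
  have [||c /andP[c1 c2] fc] := @ivt0 _ f ya yb cf.
  - lra.
  - have -> : f ya * f yb = - ((s - ya) * (yb - s) * dot n va ^+ 2) by rewrite fa fb; ring.
    by rewrite oppr_le0; apply: mulr_ge0; [apply: mulr_ge0; lra|exact: sqr_ge0].
  have cc : y1 < c < y2 by apply/andP; split; lra.
  have nc' := nPs c cc.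
  have Wc : tube V u e z0 y1 y2 (P c) by apply/(tube_in_plane hG); rewrite ?nP ?eP.
  rewrite pE (@frame_eq _ u e (P s + t *: va) (P c + (t * dot n va / dot n (V (P c))) *: V (P c)) F).
  - by apply: (tube_translate hV hG); exact: tube_flow.
  - rewrite !dotL !eP; apply: (mulIf nc'); apply/eqP; rewrite -subr_eq0 -oppr_eq0; apply/eqP.
    by rewrite -fc /f; field; exact: nc'.
  - by rewrite -/n !dotL !nP; field; exact: nc'.
have sub_tube w : tube V va ev za (dot ev (P ya)) (dot ev (P yb)) w -> tube V u e z0 y1 y2 w.
  move=> Ww; have nw := tube_transverse Ww.
  pose t := - (dot nv w - za) / dot nv (V w).
  have qz : dot nv (w + t *: V w) = za by rewrite !dotL /t; field; exact: nw.
  apply: (tube_flowE hV (t := t)); apply: sub_strip => //.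
  by apply/(tube_in_plane hGv) => //; exact: tube_flow.
pose k := dot n va *: e - dot e va *: n.
have kE x : dot k x = dot n va * dot e x - dot e va * dot n x by rewrite /k !dotL.
clearbody k.
apply: (coplanar_strip_one_parameter hV hGv (k := k)).
- by rewrite kE; ring.
- rewrite /ev dotZr dotDr dotNr dotZr !kE ee ne.
  rewrite (_ : _ * _ = r * dot n va); last by ring.
  by rewrite mulf_neq0 // gt_eqF.
move=> q qz qy; apply/eqP/negPn/negP => kq.
have Wq : tube V va ev za (dot ev (P ya)) (dot ev (P yb)) q by apply/(tube_in_plane hGv).
(* [w] is in the plane of [q], [v], [V q], at the height of the first strip;
   [tau] moves it to the edge [y2] *)
pose beta := - (dot n q - z0) / dot n va.
pose tau := (y2 - dot e q - beta * dot e va) / dot k (V q).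
pose w := (q + (tau * dot n va) *: V q) + (beta - tau * dot n (V q)) *: va.
have Ww : tube V u e z0 y1 y2 w.
  by apply: sub_tube; apply: (tube_translate hV hGv); exact: tube_flow.
have wz : dot n w = z0 by rewrite /w !dotL /beta; field; exact: na.
have : dot e w = y2.
  rewrite /w !dotL -[RHS]addr0 -(subrr (tau * dot k (V q))).
  have E : tau * dot k (V q) = y2 - dot e q - beta * dot e va by rewrite /tau; field; exact: kq.
  by rewrite {2}E kE; ring.
by move=> we; move/(tube_in_plane hG wz): Ww; rewrite we ltxx andbF.
Qed.

End SameSign.

(** * Convexity of the sets where the direction is constant *)

Section Convex.
Variables (R : realType) (V : 'rV[R]_3 -> 'rV[R]_3).
Hypothesis hV : line_fibration V.
Implicit Types (u v e n k x y p q w : 'rV[R]_3) (a b c s t : R).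

Lemma parE u v : dot u u = 1 -> dot v v = 1 -> par u v <-> dot u v ^+ 2 - 1 = 0.
Proof.
move=> uu vv; split; first by case=> ->; rewrite ?dotNr ?sqrrN uu; ring.
move=> h; apply: (@par_unit _ u v (dot u v)) => //.
apply/eqP; rewrite -subr_eq0 -dot_eq0 !dotL vv uu (dotC v u).
by apply/eqP; rewrite -[RHS]oppr0 -h; ring.
Qed.

Section OnALine.
Variables (u e p0 : 'rV[R]_3).
Hypothesis F : unit_frame u e.
Let P s : 'rV[R]_3 := p0 + s *: e.
Let n := cross u e.

Let cP : continuous P.
Proof.
apply: cont_add; first exact: cont_const.
by apply: cont_scale; [exact: cont_id|exact: cont_const].
Qed.

Let cU : continuous (fun s => dot u (V (P s))).
Proof.
by apply: (@cont_comp _ _ _ P (fun w => dot u (V w))) => //; exact: cont_dotV.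
Qed.

(** The component of [c] in the set of points whose fiber is not parallel to [u]. *)
Lemma gap_around a b c : a <= c -> c <= b -> par u (V (P a)) -> par u (V (P b)) ->
  ~ par u (V (P c)) -> exists s t, [/\ a <= s, s < c, c < t & t <= b] /\
    [/\ par u (V (P s)), par u (V (P t)) &
    gap V u e (dot n p0) (dot e p0 + s) (dot e p0 + t)].
Proof.
move=> ac cb Pa Pb Pc; have [uu ee ue] := F.
pose C := [set s | dot u (V (P s)) ^+ 2 - 1 = 0].
have CE s : C s <-> par u (V (P s)).
  by split => [h|h]; [apply/(parE uu (V_unit hV _))|apply/(parE uu (V_unit hV _)).1].
have cC : closed C.
  apply: closed_zero; apply: cont_addR; last exact: cont_const.
  exact: cont_mulR.
have [||s [as_ sc Cs Hs]] := last_point_in cC ac.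
- exact/CE.
- by move/CE.
have [||t [ct tb Ct Ht]] := first_point_in cC cb.
- exact/CE.
- by move/CE.
exists s, t; split => //; split; [exact/CE|exact/CE|].
have ne : dot n e = 0 by rewrite dotC cross_dotr.
split => //.
- by rewrite ltrD2l (lt_trans sc).
- by exists (P s); split; rewrite ?dotDr ?dotZr -/n ?ne ?ee ?mulr0 ?mulr1 ?addr0 //; exact/CE.
- by exists (P t); split; rewrite ?dotDr ?dotZr -/n ?ne ?ee ?mulr0 ?mulr1 ?addr0 //; exact/CE.
move=> p pz py; apply/eqP => n0.
pose x := dot e p - dot e p0.
have pE : p = P x + (dot u p - dot u (P x)) *: u.
  apply: (frame_eq F); rewrite /P !dotL ?ee -/n ?ne /x; first ring.
  by rewrite pz; ring.
have Vp : par u (V p).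
  apply: (@plane_par _ V hV u e (P s) p F) => //; last exact/CE.
  by rewrite -/n /P !dotL ne pz; ring.
have : C x.
  apply/CE; rewrite (_ : P x = p + (- (dot u p - dot u (P x))) *: u) ?V_par_flow //.
  by rewrite {1}pE scaleNr addrK.
have [xc|xc] := leP x c; first by apply: Hs; rewrite xc andbT /x; lra.
by apply: Ht; rewrite (ltW xc) /x; lra.
Qed.

(** Between opposite directions [V] takes a value orthogonal to [u], so there
    is a gap on each side of [b]. *)
Lemma alternating_one_parameter a b c : a <= b -> b <= c -> V (P a) = u -> V (P b) = - u ->
  V (P c) = u -> one_parameter V.
Proof.
move=> ab bc Va Vb Vc; have [uu ee ue] := F.
have np s : dot u (V (P s)) = 0 -> ~ par u (V (P s)).
  move=> h /(parE uu (V_unit hV _)); rewrite h expr0n /= sub0r => /eqP.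
  by rewrite oppr_eq0 oner_eq0.
have [|s1 /andP[as1 s1b] /np h1] := ivt0 cU ab.
  by rewrite Va Vb dotNr uu; lra.
have [|s2 /andP[bs2 s2c] /np h2] := ivt0 cU bc.
  by rewrite Vc Vb dotNr uu; lra.
have [||s [t [[_ _ _ tb] [_ _ g1]]]] := gap_around as1 s1b _ _ h1.
- by left.
- by right.
have [||s' [t' [[bs _ _ _] [_ _ g2]]]] := gap_around bs2 s2c _ _ h2.
- by right.
- by left.
apply: (two_gaps_one_parameter hV g1 g2); lra.
Qed.

(** A gap around [c] has edges [u, u], or else together with [a] or [b] it
    shows the pattern [u, -u, u]. *)
Lemma nonconvex_line_one_parameter a b c : a <= c -> c <= b -> V (P a) = u -> V (P b) = u ->
  V (P c) <> u -> one_parameter V.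
Proof.
move=> ac cb Va Vb Vc; have [uu ee ue] := F.
have ne : dot n e = 0 by rewrite dotC cross_dotr.
have [h|h] := pselect (par u (V (P c))).
  case: h => // Vc'; exact: (alternating_one_parameter ac cb).
have [||s [t [[as_ sc ct tb] [Vs Vt g]]]] := gap_around ac cb _ _ h.
- by left.
- by left.
case: Vs => Vs; last by apply: (@alternating_one_parameter a s b) => //; lra.
case: Vt => Vt; last by apply: (@alternating_one_parameter s t b) => //; lra.
apply: (same_direction_gap_one_parameter hV g (b1 := P s) (b2 := P t)) => //.
all: by rewrite /P !dotL -/n ?ne ?ee; ring.
Qed.

End OnALine.

Hypothesis h1 : ~ one_parameter V.

Lemma V_convex_perp p q (l : R) : V p = V q -> dot (V p) (q - p) = 0 ->
  0 <= l <= 1 -> V (p + l *: (q - p)) = V p.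
Proof.
move=> pq up /andP[l0 l1]; apply: contrapT => nV; apply: h1.
have [E|d0] := eqVneq (q - p) 0; first by case: nV; rewrite E scaler0 addr0.
have dd := dot_gt0 d0.
pose L := enorm (q - p).
have L2 : L ^+ 2 = dot (q - p) (q - p) by rewrite sqr_sqrtr // ltW.
have L0 : 0 < L by rewrite sqrtr_gt0.
have Ln : L != 0 by rewrite gt_eqF.
pose e := L^-1 *: (q - p).
have qpE : q - p = L *: e by rewrite scalerA mulfV // scale1r.
have F : unit_frame (V p) e.
  split; first exact: V_unit.
    by rewrite dotZl dotZr -L2; field.
  by rewrite dotZr up mulr0.
apply: (@nonconvex_line_one_parameter _ e p F 0 L (l * L)).
- by rewrite mulr_ge0 // ltW.
- by rewrite ler_piMl // ltW.
- by rewrite scale0r addr0.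
- by rewrite -qpE addrC subrK.
- by rewrite -scalerA -qpE.
Qed.

(** Sliding [q] along its fiber reduces to the case where [q - p] is orthogonal
    to the fibers. *)
Lemma V_convex p q (l : R) : V p = V q ->
  0 <= l <= 1 -> V (p + l *: (q - p)) = V p.
Proof.
move=> pq l01.
set u := V p; set s := dot u (q - p).
have uu : dot u u = 1 by exact: V_unit.
have Vq' : V (q + (- s) *: u) = V p by rewrite /u pq V_flow.
have := V_convex_perp (esym Vq') _ l01.
set r := V (p + _) => h.
have -> : p + l *: (q - p) =
   (p + l *: (q + (- s) *: u - p)) + (l * s) *: V (p + l *: (q + (- s) *: u - p)).
  rewrite -/r h; first by apply/rowP => i; rewrite !mxE -/u; ring.
  by rewrite -/u !dotL uu /s !dotL; ring.
rewrite V_flow // -/r; apply: h.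
by rewrite -/u !dotL uu /s !dotL; ring.
Qed.

Lemma Sdir_seg u x y (l : R) : Sdir V u x -> Sdir V u y -> 0 <= l <= 1 ->
  Sdir V u (x + l *: (y - x)).
Proof.
move=> [xu Vx] [yu Vy] l01; split; first by move: xu yu; rewrite /plane /= !dotL => -> ->; ring.
by move: Vx Vy => /= Vx Vy; rewrite /= V_convex ?Vx ?Vy.
Qed.

Lemma Sdir_convex u : convex_set (Sdir V u : set (convex_lmodType 'rV[R]_3)).
Proof.
move=> x y l; rewrite !inE => xS yS.
have -> : conv l x y = (y + l%:inum *: (x - y) : 'rV[R]_3).
  change (l%:inum *: x + (1 - l%:inum) *: y = (y + l%:inum *: (x - y) : 'rV[R]_3)).
  by apply/rowP => i; rewrite !mxE; ring.
by apply: Sdir_seg => //; apply/andP; split.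
Qed.

Lemma Sdir_connected u : connected (Sdir V u).
Proof.
have [[z Sz]|nS] := pselect (exists z, Sdir V u z); last first.
  rewrite (_ : Sdir V u = set0); first exact: connected0.
  by apply/seteqP; split => // x Sx; apply: nS; exists x.
rewrite (_ : Sdir V u = \bigcup_(x in Sdir V u) [set z + l *: (x - z) | l in `[0:R, 1]]).
  apply: bigcup_connected.
    exists z => x Sx; exists 0; rewrite ?scale0r ?addr0 //= in_itv /= lexx ler01 //.
  move=> x Sx; apply: connected_continuous_connected; first exact: segment_connected.
  apply: continuous_subspaceT; apply: cont_add; first exact: cont_const.
  by apply: cont_scale; [exact: cont_id|exact: cont_const].
apply/seteqP; split => x.
  move=> Sx; exists x => //; exists 1; first by rewrite /= in_itv /= lexx ler01.
  by rewrite scale1r addrC subrK.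
by move=> [y Sy [l]] /=; rewrite in_itv /= => l01 <-; exact: Sdir_seg.
Qed.

End Convex.

(** * Euclidean norm and the covering of a cone by nearby fibers *)

Section Enorm.
Variable R : realType.
Implicit Types (u v x y p q w : 'rV[R]_3) (a b c s t : R).

Lemma enorm_ge0 u : 0 <= enorm u. Proof. exact: sqrtr_ge0. Qed.
Lemma enorm_sqr u : enorm u ^+ 2 = dot u u. Proof. by rewrite sqr_sqrtr // dot_ge0. Qed.

Lemma enorm_le u c : 0 <= c -> (enorm u <= c) = (dot u u <= c ^+ 2).
Proof. by move=> c0; rewrite -enorm_sqr ler_sqr // nnegrE enorm_ge0. Qed.
Lemma enorm_lt u c : 0 <= c -> (enorm u < c) = (dot u u < c ^+ 2).
Proof. by move=> c0; rewrite -enorm_sqr ltr_sqr // nnegrE enorm_ge0. Qed.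

Lemma dot_le_enorm u v : `|dot u v| <= enorm u * enorm v.
Proof.
rewrite -ler_sqr ?nnegrE ?mulr_ge0 ?enorm_ge0 //.
by rewrite real_normK ?num_real // exprMn !enorm_sqr cauchy_dot.
Qed.

Lemma enormD u v : enorm (u + v) <= enorm u + enorm v.
Proof.
rewrite enorm_le ?addr_ge0 ?enorm_ge0 // !dotL (dotC v u) sqrrD !enorm_sqr.
have := ler_norm (dot u v); have := dot_le_enorm u v; lra.
Qed.

Lemma enormZ s u : enorm (s *: u) = `|s| * enorm u.
Proof.
by rewrite /enorm dotZl dotZr mulrA -expr2 sqrtrM ?sqr_ge0 // sqrtr_sqr.
Qed.

Lemma enormN u : enorm (- u) = enorm u.
Proof. by rewrite -scaleN1r enormZ normrN1 mul1r. Qed.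

Lemma enorm_unit u : dot u u = 1 -> enorm u = 1.
Proof. by rewrite /enorm => ->; rewrite sqrtr1. Qed.

Definition perp u w : 'rV[R]_3 := w - dot u w *: u.

Lemma coord_le_enorm u i : `|u 0 i| <= enorm u.
Proof.
rewrite -ler_sqr ?nnegrE ?enorm_ge0 // real_normK ?num_real // enorm_sqr dotE.
have h0 := sqr_ge0 (u 0 0); have h1 := sqr_ge0 (u 0 1); have h2 := sqr_ge0 (u 0 2).
case: i => [[|[|[|//]]] Hi].
- by rewrite (_ : Ordinal Hi = 0) ?expr2; [lra|exact: val_inj].
- by rewrite (_ : Ordinal Hi = 1) ?expr2; [lra|exact: val_inj].
- by rewrite (_ : Ordinal Hi = 2) ?expr2; [lra|exact: val_inj].
Qed.

Lemma norm_le_enorm u : `|u| <= enorm u.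
Proof.
rewrite [leLHS]/Num.norm /= mx_normrE; apply/bigmax_leP; split; first exact: enorm_ge0.
by move=> [i j] _ /=; rewrite ord1 coord_le_enorm.
Qed.

Lemma compact_ebounded (A : set 'rV[R]_3) (M : R) :
  closed A -> (forall x, A x -> enorm x <= M) -> compact A.
Proof.
move=> cA AM; apply: bounded_closed_compact => //.
exists M; split; first exact: num_real.
move=> x Mx y Ay /=; apply: le_trans (norm_le_enorm _) _.
by apply: le_trans (AM _ Ay) _; exact: ltW.
Qed.

(** The maximum is attained. *)
Lemma compact_max (A : set 'rV[R]_3) (f : 'rV[R]_3 -> R) (d : R) :
  compact A -> continuous f -> (forall x, A x -> f x < d) ->
  exists2 c, c < d & forall x, A x -> f x <= c.
Proof.
move=> cA cf Ad; have [A0|/set0P A0] := eqVneq A set0.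
  by exists (d - 1); [lra|move=> x; rewrite A0].
have [c Ac fc] := compact_EVT_max A0 cA (continuous_subspaceT cf).
by exists (f c) => [|x Ax]; [apply: Ad; rewrite -inE|apply: fc; rewrite inE].
Qed.

End Enorm.

Section Covering.
Variables (R : realType) (V : 'rV[R]_3 -> 'rV[R]_3).
Hypothesis hV : line_fibration V.
Implicit Types (u v e n k x y p q w : 'rV[R]_3) (a b c s t : R).

Lemma unit_dot1 u v : dot u u = 1 -> dot v v = 1 -> dot u v = 1 -> v = u.
Proof.
move=> uu vv uv; apply/eqP; rewrite -subr_eq0 -dot_eq0 !dotL vv uu (dotC v) uv.
by apply/eqP; ring.
Qed.

Lemma unit_dot_le1 u v : dot u u = 1 -> dot v v = 1 -> dot u v <= 1.
Proof. by move=> uu vv; have := cauchy_dot u v; rewrite uu vv => h; nra. Qed.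

Lemma dirs_unit u : dirs V u -> dot u u = 1.
Proof. by move=> [p _ <-]; exact: V_unit. Qed.

Lemma Sdir_nonempty u : dirs V u -> exists z, Sdir V u z.
Proof.
move=> du; have uu := dirs_unit du; case: du => p _ pE; exists (p + (- dot u p) *: u); split.
  by rewrite /plane /= !dotL uu; ring.
by rewrite /= -pE V_flow.
Qed.

(** All points deep inside the double cone around [u] lie on fibers through
    the open set [D] of points [q] in the plane orthogonal to [u] with [|q| < M]
    and [u . V q > k]. On the compact frontier [Bd] of [D] the direction stays
    away from [u], so a fiber through [Bd] is far from the axis at height [h],
    at distance at least [c |h| - M]. Inside the plane at height [h], walk from
    the fiber of a point of [S_u] to the given point: the fiber cannot leave
    [D]. *)
Lemma covering u (k : R) : dirs V u -> compact (Sdir V u) -> 0 < k < 1 ->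
  exists c M : R, [/\ 0 < c, 0 < M & forall w,
    enorm (perp u w) + 2 * M < c * `|dot u w| ->
    k < dot u (V w) /\
    exists q s, [/\ dot u q = 0, enorm q < M & w = q + s *: V w]].
Proof.
move=> du cS /andP[k0 k1]; have uu := dirs_unit du.
have [z Sz] := Sdir_nonempty du.
have cE : continuous (fun q : 'rV[R]_3 => dot q q) by apply: cont_dot; exact: cont_id.
have cU : continuous (fun q => dot u (V q)) by exact: cont_dotV.
have [M M0 SM] : exists2 M : R, 0 < M & forall q, Sdir V u q -> enorm q < M.
  have [z' Sz' zmax] := compact_EVT_max (ex_intro _ z Sz) cS (continuous_subspaceT cE).
  exists (enorm z' + 1); first by have := enorm_ge0 z'; lra.
  move=> q Sq; suff : enorm q <= enorm z' by lra.
  by rewrite enorm_le ?enorm_ge0 // enorm_sqr zmax // inE.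
pose Bd := [set q | dot u q = 0] `&` [set q | 0 <= M ^+ 2 - dot q q] `&`
   [set q | 0 <= dot u (V q) - k] `&` [set q | (M ^+ 2 - dot q q) * (dot u (V q) - k) = 0].
have cM : continuous (fun q : 'rV[R]_3 => M ^+ 2 - dot q q).
  by apply: cont_addR; [exact: cont_const|exact: cont_oppR].
have ck : continuous (fun q => dot u (V q) - k).
  by apply: cont_addR => //; exact: cont_const.
have cBd : compact Bd.
  apply: (@compact_ebounded _ _ M).
    apply: closedI; first apply: closedI; first apply: closedI.
    - by apply: closed_zero; exact: cont_dotc.
    - exact: closed_nneg.
    - exact: closed_nneg.
    - by apply: closed_zero; exact: cont_mulR.
  by move=> q [] [] [] _ /=; rewrite subr_ge0 enorm_le // ltW.
have [eta /andP[eta0 eta1] Beta] : exists2 eta, 0 < eta < 1 &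
    forall q, Bd q -> dot u (V q) <= eta.
  have [|eta eta1 h] := @compact_max _ Bd _ 1 cBd cU.
    move=> q [] [] [] /= uq qM kq h.
    rewrite lt_neqAle (unit_dot_le1 uu (V_unit hV q)) andbT; apply/eqP => uV.
    have Sq : Sdir V u q by split => //=; apply: unit_dot1 => //; exact: V_unit.
    have := SM _ Sq; rewrite enorm_lt ?(ltW M0) // => qM'.
    by move/eqP: h; rewrite mulf_eq0 uV => /orP[] /eqP; lra.
  exists (Num.max eta k); first by rewrite lt_max k0 orbT gt_max eta1 k1.
  by move=> q Bq; rewrite le_max h.
pose c := Num.sqrt (1 - eta ^+ 2).
have c2 : c ^+ 2 = 1 - eta ^+ 2 by rewrite sqr_sqrtr // subr_ge0; nra.
have c0 : 0 < c by rewrite sqrtr_gt0; nra.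
have far q t : Bd q -> c * `|t * dot u (V q)| <= enorm (perp u (q + t *: V q)) + M.
  move=> Bq; have fe := Beta _ Bq; case: Bq => -[] [] /= uq qM kq _.
  have qM' : enorm q <= M by rewrite enorm_le ?(ltW M0) // -subr_ge0.
  have pE : t *: perp u (V q) = perp u (q + t *: V q) + (- q).
    by rewrite /perp !dotL uq; apply/rowP => i; rewrite !mxE; ring.
  have pc : c <= enorm (perp u (V q)).
    rewrite -ler_sqr ?nnegrE ?enorm_ge0 ?(ltW c0) // enorm_sqr c2 /perp !dotL.
    by rewrite uu V_unit // (dotC (V q)); nra.
  have f01 : `|dot u (V q)| <= 1 by rewrite ger0_norm; lra.
  have h1 : `|t| * enorm (perp u (V q)) <= enorm (perp u (q + t *: V q)) + M.
    rewrite -enormZ pE; apply: le_trans (enormD _ _) _.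
    by rewrite enormN lerD2l.
  apply: le_trans h1; rewrite normrM mulrCA ler_wpM2l //.
  by rewrite -[leRHS]mulr1 ler_pM // ltW.
exists c, M; split => // w hw.
pose h := dot u w.
pose g (t : R) : 'rV[R]_3 := h *: u + (z + t *: (perp u w - z)).
have uz : dot u z = 0 by case: Sz.
have Vz : V z = u by case: Sz.
have ug t : dot u (g t) = h.
  by rewrite /g /perp !dotL uu uz -/h; ring.
have pg t : perp u (g t) = (1 - t) *: z + t *: perp u w.
  rewrite {1}/perp ug /g; move: (perp u w) (h) => pw h'.
  by apply/rowP => i; rewrite !mxE; ring.
(* [0 < G x] says that this fiber meets that plane within distance [M] *)
pose G x := M ^+ 2 * dot u (V x) ^+ 2 -
  dot (dot u (V x) *: x - dot u x *: V x) (dot u (V x) *: x - dot u x *: V x).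
have cG : continuous G.
  apply: cont_addR.
    by apply: cont_mulR; [exact: cont_const|exact: cont_mulR].
  have c1 : continuous (fun x => dot u (V x) *: x - dot u x *: V x).
    apply: cont_add; first by apply: cont_scale => //; exact: cont_id.
    by apply: cont_opp; apply: cont_scale; [exact: cont_dotc|exact: V_cont].
  by apply: cont_oppR; exact: cont_dot.
(* the point where the fiber of [x] meets the plane orthogonal to [u] *)
pose pr x := x + (- (dot u x / dot u (V x))) *: V x.
have Gpr x : dot u (V x) != 0 -> G x = dot u (V x) ^+ 2 * (M ^+ 2 - dot (pr x) (pr x)).
  move=> f0; rewrite /G mulrBr [M ^+ 2 * _]mulrC; congr (_ - _).
  have -> : dot u (V x) *: x - dot u x *: V x = dot u (V x) *: pr x.
    by rewrite /pr; apply/rowP => i; rewrite !mxE; field.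
  by rewrite !dotL; ring.
have upr x : dot u (V x) != 0 -> dot u (pr x) = 0 by move=> f0; rewrite !dotL; field.
pose A := [set x | 0 < dot u (V x) - k] `&` [set x | 0 < G x].
have : A (g 1).
  apply: path_open_closed.
  - apply: cont_add; first exact: cont_const.
    apply: cont_add; first exact: cont_const.
    by apply: cont_scale; [exact: cont_id|exact: cont_const].
  - by apply: openI; apply: open_pos.
  - have g0 : g 0 = z + h *: u by rewrite /g scale0r addr0 addrC.
    have Vg : V (g 0) = u by rewrite g0 V_par_flow // Vz; left.
    split; rewrite /= ?Gpr ?Vg ?uu ?oner_eq0 ?subr_gt0 //.
    rewrite expr1n mul1r subr_gt0 -enorm_lt ?(ltW M0) //.
    rewrite (_ : pr _ = z) ?SM // /pr Vg uu ug divr1 g0.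
    by rewrite scaleNr addrK.
  move=> t /andP[t0 t1] clA.
  have kf : 0 <= dot u (V (g t)) - k.
    by apply: (closure_nneg ck _ clA) => x [] /= + _; exact: ltW.
  have G0 : 0 <= G (g t) by apply: (closure_nneg cG _ clA) => x [] _ /=; exact: ltW.
  have f0 : 0 < dot u (V (g t)) by lra.
  have fn0 : dot u (V (g t)) != 0 by rewrite gt_eqF.
  have Vpr : V (pr (g t)) = V (g t) by rewrite V_flow.
  move: G0; rewrite Gpr // pmulr_rge0 ?exprn_even_gt0 // => G0.
  apply: contrapT => nA.
  have Bq : Bd (pr (g t)).
    split; first split; first split; rewrite /= ?Vpr //; first exact: upr.
    apply/eqP; rewrite mulf_eq0; apply/negPn/negP; rewrite negb_or => /andP[n1 n2].
    apply: nA; split => /=; first by rewrite lt_neqAle eq_sym n2.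
    by rewrite Gpr // pmulr_rgt0 ?exprn_even_gt0 // lt_neqAle eq_sym n1.
  have := far _ (h / dot u (V (g t))) Bq.
  rewrite Vpr divfK // (_ : pr _ + _ = g t); last first.
    by rewrite /pr ug -addrA -scalerDl addNr scale0r addr0.
  rewrite pg leNgt => /negP; apply.
  apply: le_lt_trans hw; rewrite mulr_natl mulr2n addrA lerD2r.
  apply: le_trans (enormD _ _) _; rewrite !enormZ addrC !ger0_norm ?subr_ge0 //.
  have := enorm_ge0 z; have := enorm_ge0 (perp u w); have := SM _ Sz.
  move: (enorm z) (enorm _) => a b ? ? ?; nra.
have -> : g 1 = w.
  by rewrite /g scale1r /perp /h; apply/rowP => i; rewrite !mxE; ring.
move=> [/= kf G0]; split; first by rewrite -subr_gt0.
have fn0 : dot u (V w) != 0 by rewrite gt_eqF //; lra.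
exists (pr w), (dot u w / dot u (V w)); split; first exact: upr.
  by move: G0; rewrite Gpr // pmulr_rgt0 ?exprn_even_gt0 // subr_gt0 -enorm_lt ?(ltW M0).
by rewrite /pr -addrA -scalerDl addNr scale0r addr0.
Qed.

End Covering.

(** * Continuity at infinity *)

Section Infinity.
Variables (R : realType) (V : 'rV[R]_3 -> 'rV[R]_3).
Hypothesis hV : line_fibration V.
Implicit Types (u v e n k x y q w : 'rV[R]_3) (a b c s t : R).

Lemma enorm_perp_le u y : dot u u = 1 -> enorm (perp u y) <= enorm y.
Proof.
move=> uu; rewrite enorm_le ?enorm_ge0 // enorm_sqr /perp !dotL uu (dotC y u).
have := sqr_ge0 (dot u y); lra.
Qed.

Lemma half01 : 0 < (1 / 2 : R) < 1. Proof. by apply/andP; split; lra. Qed.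

(** The fiber of direction [- u] enters the cone of [covering]. *)
Lemma no_antipode u : dirs V u -> compact (Sdir V u) -> ~ dirs V (- u).
Proof.
move=> du cS [q _ Vq]; have uu := dirs_unit hV du.
have [c [M [c0 M0 H]]] := covering hV du cS half01.
pose h := (enorm (perp u q) + 2 * M) / c + 1 - dot u q.
have pE : perp u (q + h *: u) = perp u q.
  by rewrite /perp !dotL uu; apply/rowP => i; rewrite !mxE; ring.
have A0 : 0 <= enorm (perp u q) + 2 * M by have := enorm_ge0 (perp u q); lra.
have [] := H (q + h *: u).
  have -> : dot u (q + h *: u) = (enorm (perp u q) + 2 * M) / c + 1.
    by rewrite !dotL uu /h; ring.
  rewrite pE ger0_norm; last by rewrite addr_ge0 // divr_ge0 // ltW.
  by rewrite mulrDr mulrCA divff ?gt_eqF // !mulr1 ltrDl.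
rewrite V_par_flow //; last by rewrite Vq; right; rewrite ?opprK.
by rewrite Vq dotNr uu; lra.
Qed.

Lemma compact_continuous_at_infinity u : dirs V u -> compact (Sdir V u) -> continuous_at_infinity V u.
Proof.
move=> du cS p pinf pu; have uu := dirs_unit hV du.
apply/cvgrPdist_lt => eps eps0.
pose k := Num.max (1 / 2) (1 - eps ^+ 2 / 2).
have k01 : 0 < k < 1.
  have e2 : 0 < eps ^+ 2 by rewrite exprn_gt0.
  by rewrite lt_max gt_max; apply/andP; split; [apply/orP; left|apply/andP; split]; lra.
have [c [M [c0 M0 H]]] := covering hV du cS k01.
(* an angle such that [th < c (1 - th)], with a margin for the constant [2 M] *)
pose th := c / (2 * (1 + c)).
have th0 : 0 < th by rewrite divr_gt0 // mulr_gt0 //; lra.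
have thE : th * (1 + c) = c / 2 by rewrite /th; field; apply/eqP; lra.
have pu' : \forall i \near \oo, `|0 - Num.min (enorm ((enorm (p i))^-1 *: p i - u))
    (enorm ((enorm (p i))^-1 *: p i + u))| < th.
  by move: pu; rewrite /cvg_RP2 => /cvgrPdist_lt /(_ _ th0).
near=> i.
have P4 : 4 * M / c < enorm (p i).
  by near: i; apply: (cvgry_gt pinf).
have P0 : 0 < enorm (p i) by apply: lt_trans P4; rewrite divr_gt0 // mulr_gt0.
have mth : `|0 - Num.min (enorm ((enorm (p i))^-1 *: p i - u))
    (enorm ((enorm (p i))^-1 *: p i + u))| < th.
  by near: i; exact: pu'.
set P := enorm (p i) in P4 P0 mth *.
pose x : 'rV[R]_3 := P^-1 *: p i.
have pE : p i = P *: x by rewrite scalerA mulfV ?gt_eqF // scale1r.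
have {}mth : Num.min (enorm (x - u)) (enorm (x + u)) < th.
  by move: mth; rewrite sub0r normrN ger0_norm // le_min !enorm_ge0.
clearbody x.
have [px ux] : enorm (perp u x) < th /\ 1 - th < `|dot u x|.
  move: mth; rewrite gt_min => /orP[] h.
    split.
      have -> : perp u x = perp u (x - u).
        by rewrite /perp !dotL uu; apply/rowP => j; rewrite !mxE; ring.
      exact: le_lt_trans (enorm_perp_le _ uu) h.
    have := dot_le_enorm u (x - u); rewrite (enorm_unit uu) mul1r !dotL uu => h2.
    have := ler_norm (- (dot u x - 1)); have := ler_norm (dot u x); rewrite normrN; lra.
  split.
    have -> : perp u x = perp u (x + u).
      by rewrite /perp !dotL uu; apply/rowP => j; rewrite !mxE; ring.
    exact: le_lt_trans (enorm_perp_le _ uu) h.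
  have := dot_le_enorm u (x + u); rewrite (enorm_unit uu) mul1r !dotL uu => h2.
  have := ler_norm (dot u x + 1); have := ler_norm (- dot u x); rewrite normrN; lra.
have [] := H (p i).
  have -> : perp u (p i) = P *: perp u x.
    by rewrite pE /perp !dotL; apply/rowP => j; rewrite !mxE; ring.
  rewrite pE dotZr normrM enormZ gtr0_norm //.
  have h1 : P * enorm (perp u x) <= P * th by rewrite ler_wpM2l // ltW.
  have h2 : c * P * (1 - th) <= c * P * `|dot u x| by rewrite ler_wpM2l // ?mulr_ge0 // ltW.
  have h3 : 4 * M < P * c by rewrite -ltr_pdivrMr.
  have h4 : P * th * (1 + c) = P * c / 2 by rewrite -mulrA thE; ring.
  rewrite mulrA; lra.
rewrite gt_max => /andP[_ Vk] _.
apply: le_lt_trans (norm_le_enorm _) _.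
rewrite enorm_lt ?(ltW eps0) // !dotL uu V_unit // (dotC _ u); lra.
Unshelve. all: by end_near.
Qed.

End Infinity.

(** * Geodesic convexity of the set of directions *)

Section Coplanar.
Variable R : realType.
Implicit Types (a b c d n : 'rV[R]_3).

Lemma cramer_dual a b n d : dot (cross a b) n *: d =
  dot (cross d b) n *: a + dot (cross a d) n *: b + dot (cross a b) d *: n.
Proof. vring. Qed.

Lemma coplanar_det a b d n : n != 0 -> dot a n = 0 -> dot b n = 0 -> dot d n = 0 ->
  dot (cross a b) d = 0.
Proof.
move=> n0 an bn dn; have : dot (cross a b) d *: n =
    dot a n *: cross b d + dot b n *: cross d a + dot d n *: cross a b by vring.
rewrite an bn dn !scale0r !addr0 => /eqP.
by rewrite scaler_eq0 (negbTE n0) orbF => /eqP.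
Qed.

Lemma coplanar_span n a b d : n != 0 -> dot a n = 0 -> dot b n = 0 -> dot d n = 0 ->
  cross a b != 0 -> exists s t, d = s *: a + t *: b.
Proof.
move=> n0 an bn dn ab0.
have D0 : dot (cross a b) n != 0.
  have : dot (cross a b) n ^+ 2 = dot (cross a b) (cross a b) * dot n n.
    transitivity (dot (cross a b) (cross a b) * dot n n -
      dot (dot a n *: b - dot b n *: a) (dot a n *: b - dot b n *: a)); first by dring.
    by rewrite an bn !scale0r subr0 dot0l subr0.
  move=> E; apply/eqP => D0; move/eqP: E; rewrite D0 expr0n /= eq_sym mulf_eq0.
  by rewrite !dot_eq0 (negbTE ab0) (negbTE n0).
have := cramer_dual a b n d; rewrite (coplanar_det n0 an bn dn) scale0r addr0 => E.
exists (dot (cross d b) n / dot (cross a b) n), (dot (cross a d) n / dot (cross a b) n).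
apply: (scalerI D0); rewrite E; apply/rowP => i; rewrite !mxE; field; exact: D0.
Qed.

Lemma cross0_par a b : dot a a = 1 -> dot b b = 1 -> cross a b = 0 -> par a b.
Proof.
move=> aa bb ab; apply: (@par_unit _ a b (dot a b)) => //.
have : dot a a *: b = dot a b *: a - cross a (cross a b) by vring.
have -> : cross a (cross a b) = 0 by rewrite ab; vring.
by rewrite aa scale1r subr0.
Qed.
End Coplanar.

Section GeodConvex.
Variables (R : realType) (V : 'rV[R]_3 -> 'rV[R]_3).
Hypothesis hV : line_fibration V.
Implicit Types (u v e n k x y p q w : 'rV[R]_3) (a b c s t : R).

(** The fiber through a point [h u - 2 M n] passes within [M] of the origin, so
    it must climb along [n] when travelling back from height [h] to height 0; the
    sign of [h] decides the sign of [n . V]. *)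
Lemma both_signs u n : dirs V u -> compact (Sdir V u) -> dot n n = 1 -> dot u n = 0 ->
  (exists w, dot n (V w) < 0) /\ (exists w, 0 < dot n (V w)).
Proof.
move=> du cS nn un; have uu := dirs_unit hV du.
have [c [M [c0 M0 H]]] := covering hV du cS (half01 R).
have main (sg : R) : `|sg| = 1 -> exists w, sg * dot n (V w) < 0.
  move=> sg1; have sg2 : sg * sg = 1 by rewrite -expr2 -(real_normK (num_real sg)) sg1 expr1n.
  pose h := 4 * M / c + 1.
  have h0 : 0 < h by rewrite addr_gt0 // divr_gt0 // mulr_gt0.
  pose w := (sg * h) *: u + (- (2 * M)) *: n.
  have uw : dot u w = sg * h by rewrite !dotL uu un; ring.
  have nw : dot n w = - (2 * M) by rewrite !dotL (dotC n u) un nn; ring.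
  have pw : perp u w = (- (2 * M)) *: n.
    by rewrite /perp uw /w; apply/rowP => i; rewrite !mxE; ring.
  have M20 : 0 < 2 * M by rewrite mulr_gt0.
  clearbody w; have [] := H w.
    rewrite pw uw enormZ (enorm_unit nn) normrN [`|sg * h|]normrM sg1 !gtr0_norm // mulr1 mul1r.
    rewrite /h mulrDr mulrCA divff ?gt_eqF // !mulr1; lra.
  move=> f0 [q [s [uq qM wE]]]; exists w.
  have E1 : s * dot u (V w) = sg * h by rewrite -uw {2}wE !dotL uq add0r.
  have E2 : s * dot n (V w) = - (2 * M) - dot n q by rewrite -nw {2}wE !dotL; ring.
  have nq : - M < dot n q.
    have := dot_le_enorm n q; rewrite (enorm_unit nn) mul1r.
    have := ler_norm (- dot n q); rewrite normrN; lra.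
  have f00 : 0 < dot u (V w) by lra.
  have ss : 0 < sg * s.
    rewrite -(pmulr_lgt0 _ f00) -mulrA E1 mulrA sg2 mul1r //.
  rewrite -(pmulr_rlt0 _ ss) mulrA -[sg * s * sg]mulrAC sg2 mul1r E2; lra.
have [w1 h1] := main 1 (normr1 _).
have [w2 h2] := main (-1) (normrN1 _).
by split; [exists w1|exists w2]; lra.
Qed.

Section Levels.
Hypothesis allc : forall u, dirs V u -> compact (Sdir V u).
Variable n : 'rV[R]_3.
Hypothesis nn : dot n n = 1.

(** Two fibers in the same plane are parallel, and opposite directions are
    excluded by [no_antipode]. *)
Lemma tangent_unique p q : dot n p = dot n q -> dot n (V p) = 0 -> dot n (V q) = 0 ->
  V p = V q.
Proof.
move=> npq np nq.
have n0 : n != 0 by rewrite -dot_eq0 nn oner_eq0.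
have [c0|c0] := eqVneq (cross (V p) (V q)) 0.
  case: (cross0_par (V_unit hV p) (V_unit hV q) c0) => // E.
  have dp : dirs V (V p) by exists p.
  case: (no_antipode hV dp (allc dp)); exists q => //.
have [||| s [t E]] := coplanar_span (d := q - p) n0 _ _ _ c0.
- by rewrite dotC.
- by rewrite dotC.
- by rewrite dotC !dotL npq subrr.
apply: (V_meet hV (s := s) (t := - t)).
by rewrite -{1}[q](subrK p) E; apply/rowP => i; rewrite !mxE; ring.
Qed.

Hypothesis wneg : exists w, dot n (V w) < 0.
Hypothesis wpos : exists w, 0 < dot n (V w).

(** A fiber transverse to [n] crosses all planes orthogonal to [n]. *)
Lemma level_signs t : (exists2 p, dot n p = t & dot n (V p) < 0) /\
  (exists2 p, dot n p = t & 0 < dot n (V p)).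
Proof.
split.
  case: wneg => w h; exists (w + ((t - dot n w) / dot n (V w)) *: V w); last by rewrite V_flow.
  by rewrite !dotL; field; rewrite lt_eqF.
case: wpos => w h; exists (w + ((t - dot n w) / dot n (V w)) *: V w); last by rewrite V_flow.
by rewrite !dotL; field; rewrite gt_eqF.
Qed.

Definition levels (O : set 'rV[R]_3) : set R :=
  [set t | exists p, [/\ dot n p = t, dot n (V p) = 0 & O (V p)]].

(** A segment of the plane at level [t0] with opposite signs of [n . V] at its
    ends keeps them when it is shifted to a nearby level, so it still carries a
    zero of [n . V]. By compactness of the segment this zero lies near a zero at
    level [t0], where the direction is in [O]. *)
Lemma levels_open O : open O -> open (levels O).
Proof.
move=> oO; rewrite openE => t0 [p0 [p0t p0V p0O]].
have [[p pt pV] [q qt qV]] := level_signs t0.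
pose g (z : R * R) : 'rV[R]_3 := (p + z.1 *: (q - p)) + (z.2 - t0) *: n.
have cg : continuous g.
  have c1 : continuous (fun z : R * R => z.1) by move=> z; exact: cvg_fst.
  have c2 : continuous (fun z : R * R => z.2) by move=> z; exact: cvg_snd.
  apply: cont_add.
    by apply: cont_add; [exact: cont_const|apply: cont_scale => //; exact: cont_const].
  apply: cont_scale; last exact: cont_const.
  by apply: cont_addR => //; exact: cont_const.
pose N := [set w | dot n (V w) != 0] `|` V @^-1` O.
have cn : continuous (fun w => dot n (V w)) by exact: cont_dotV.
have oN : open N.
  apply: openU; last by apply: open_comp => // w _; exact: V_cont.
  rewrite (_ : [set w | _] = [set w | 0 < dot n (V w)] `|` [set w | 0 < - dot n (V w)]).
    by apply: openU; apply: open_pos => //; exact: cont_oppR.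
  apply/seteqP; split => w /=; rewrite oppr_gt0 neq_lt; first by case/orP; [right|left].
  by case=> ->; rewrite ?orbT.
have /compact_near_coveringP cK := @segment_compact R 0 1.
have ng z : dot n (g z) = z.2.
  by rewrite /g !dotL pt qt nn; ring.
have near1 : \forall t \near t0, `[0, 1]%classic `<=` (fun s => N (g (s, t))).
  apply: (cK R (nbhs t0) (fun t s => N (g (s, t)))) => s _.
  have Ng : N (g (s, t0)).
    have [h|h] := eqVneq (dot n (V (g (s, t0)))) 0; last by left.
    right; rewrite /= (@tangent_unique _ p0) // ng p0t //.
  have : nbhs (s, t0) (g @^-1` N) by apply: cg; exact: open_nbhs_nbhs.
  by apply: filterS => -[].
have cgt s : continuous (fun t => dot n (V (g (s, t)))).
  apply: (@cont_comp _ _ _ (fun t => g (s, t)) (fun w => dot n (V w))) => //.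
  apply: (@cont_comp _ _ _ (fun t => (s, t)) g) => //.
  by apply: cont_pair; [exact: cont_const|exact: cont_id].
have near2 : \forall t \near t0, 0 < - dot n (V (g (0, t))).
  have : open [set t | 0 < - dot n (V (g (0, t)))] by apply: open_pos; exact: cont_oppR.
  rewrite openE => /(_ t0); apply.
  by rewrite /= /g /= scale0r addr0 subrr scale0r addr0 oppr_gt0.
have near3 : \forall t \near t0, 0 < dot n (V (g (1, t))).
  have : open [set t | 0 < dot n (V (g (1, t)))] by exact: open_pos.
  rewrite openE => /(_ t0); apply.
  by rewrite /= /g /= scale1r subrr scale0r addr0 addrC subrK.
rewrite /interior; near=> t.
have h2 : 0 < - dot n (V (g (0, t))) by near: t.
have h3 : 0 < dot n (V (g (1, t))) by near: t.
have cs : continuous (fun s => dot n (V (g (s, t)))).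
  apply: (@cont_comp _ _ _ (fun s => g (s, t)) (fun w => dot n (V w))) => //.
  apply: (@cont_comp _ _ _ (fun s => (s, t)) g) => //.
  by apply: cont_pair; [exact: cont_id|exact: cont_const].
have [||s s01 s0] := ivt0 cs (a := 0) (b := 1).
- exact: ler01.
- by nra.
have h1 : `[0, 1]%classic `<=` (fun s => N (g (s, t))) by near: t.
exists (g (s, t)); split; [exact: ng|exact: s0|].
have := h1 s; rewrite /= in_itv /= => /(_ s01) [] //=.
by rewrite s0 eqxx.
Unshelve. all: by end_near.
Qed.

Lemma levels_all t : exists2 p, dot n p = t & dot n (V p) = 0.
Proof.
have [[p pt pV] [q qt qV]] := level_signs t.
have c : continuous (fun s => dot n (V (p + s *: (q - p)))).
  apply: (@cont_comp _ _ _ (fun s => p + s *: (q - p)) (fun w => dot n (V w))).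
    apply: cont_add; first exact: cont_const.
    by apply: cont_scale; [exact: cont_id|exact: cont_const].
  exact: cont_dotV.
have [||s _ s0] := ivt0 c (a := 0) (b := 1).
- exact: ler01.
- by rewrite scale0r addr0 scale1r [p + _]addrC subrK; nra.
exists (p + s *: (q - p)) => //.
by rewrite !dotL pt qt; ring.
Qed.

(** By connectedness of the line of levels: [levels O1] and [levels O2] are
    open and disjoint, and they cover it. *)
Lemma levels_split O1 O2 p q : open O1 -> open O2 -> O1 `&` O2 = set0 ->
  (forall p, dot n (V p) = 0 -> O1 (V p) \/ O2 (V p)) ->
  dot n (V p) = 0 -> O1 (V p) -> dot n (V q) = 0 -> O2 (V q) -> False.
Proof.
move=> o1 o2 o12 cov np Op nq Oq.
have dis t : levels O1 t -> levels O2 t -> False.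
  move=> [x [xt xV xO]] [y [yt yV yO]].
  suff : set0 (V x) by [].
  by rewrite -o12; split => //; rewrite (@tangent_unique x y) // xt yt.
apply: (dis (dot n q)); last by exists q.
have -> : dot n q = dot n p + 1 * (dot n q - dot n p) by ring.
apply: (@path_open_closed R _ (levels O1) (fun s => dot n p + s * (dot n q - dot n p))).
- apply: cont_addR; first exact: cont_const.
  by apply: cont_mulR; [exact: cont_id|exact: cont_const].
- exact: levels_open.
- by rewrite mul0r addr0; exists p.
move=> s _; set t := _ + _ => cl.
have [x xt xV] := levels_all t.
case: (cov x xV) => Ox; first by exists x.
have : levels O2 t by exists x.
move=> l2; have /cl [y [y1 y2]] : nbhs t (levels O2).
  by apply: open_nbhs_nbhs; split => //; exact: levels_open.
by case: (dis y).
Qed.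

End Levels.

(** Write [w = A u + B v] up to the positive factor [D] on the great circle of
    [u] and [v]. Without [- u], [- v] and the point [x] of the short arc, this
    circle falls into the open arc [O1] from [- v] to [x], which contains [u],
    and the rest [O2], which contains [v]. *)
Lemma dirs_geodesically_convex : (forall u, dirs V u -> compact (Sdir V u)) ->
  geodesically_convex (dirs V).
Proof.
move=> allc u v du dv uv uNv x [x1 [a [b [a0 b0 xE]]]].
have uu := dirs_unit hV du; have vv := dirs_unit hV dv.
have xx : dot x x = 1 by rewrite -enorm_sqr x1 expr1n.
have [b00|bn0] := eqVneq b 0.
  move: xE; rewrite b00 scale0r addr0 => xE; move: xx; rewrite xE !dotL uu mulr1 => aa.
  have -> : a = 1 by nra.
  by rewrite scale1r.
have [a00|an0] := eqVneq a 0.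
  move: xE; rewrite a00 scale0r add0r => xE; move: xx; rewrite xE !dotL vv mulr1 => bb.
  have -> : b = 1 by nra.
  by rewrite scale1r.
have {an0}a0 : 0 < a by rewrite lt_neqAle eq_sym an0.
have {bn0}b0 : 0 < b by rewrite lt_neqAle eq_sym bn0.
apply: contrapT => ndx.
pose m := cross u v.
have m0 : m != 0.
  apply/eqP => /(cross0_par uu vv) [] E; first by move: uv; rewrite E eqxx.
  by move: uNv; rewrite E opprK eqxx.
pose D := dot m m.
have D0 : 0 < D by exact: dot_gt0.
pose r := (Num.sqrt D)^-1.
have r0 : r != 0 by rewrite invr_neq0 // gt_eqF // sqrtr_gt0.
pose n := r *: m.
have nn : dot n n = 1.
  by rewrite !dotL -/D mulrA -expr2 exprVn sqr_sqrtr ?mulVf ?gt_eqF // ltW.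
have un : dot u n = 0 by rewrite dotZr cross_dotl mulr0.
have vn : dot v n = 0 by rewrite dotZr cross_dotr mulr0.
have [wneg wpos] := both_signs du (allc u du) nn un.
pose A w := dot (cross v m) w; pose B w := dot (cross m u) w.
have DE w : dot n w = 0 -> D *: w = A w *: u + B w *: v.
  move=> nw; have mw : dot m w = 0 by apply: (mulfI r0); rewrite -dotZl nw mulr0.
  rewrite (cramer_dual u v m w) -/m mw scale0r addr0.
  by congr (_ *: _ + _ *: _); rewrite /A /B; dring.
have Au : A u = D by rewrite /A /D /m; dring.
have Bu : B u = 0 by rewrite /B; dring.
have Av : A v = 0 by rewrite /A; dring.
have Bv : B v = D by rewrite /B /D /m; dring.
have cA : continuous A by exact: cont_dotc.
have cB : continuous B by exact: cont_dotc.
pose E w := b * A w - a * B w.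
have cE : continuous E.
  apply: cont_addR; first by apply: cont_mulR => //; exact: cont_const.
  by apply: cont_oppR; apply: cont_mulR => //; exact: cont_const.
pose O1 := [set w | 0 < A w] `&` [set w | 0 < E w].
pose O2 := ([set w | 0 < - E w] `&` [set w | 0 < B w]) `|`
           ([set w | 0 < - A w] `&` [set w | 0 < - B w]).
have anti w : dirs V w -> forall p, V p <> - w.
  by move=> dw p E'; apply: (no_antipode hV dw (allc w dw)); exists p.
have unitD w z (k : R) : dot w w = 1 -> dot z z = 1 -> D *: w = k *: z ->
    (0 < k -> w = z) /\ (k < 0 -> w = - z) /\ k != 0.
  move=> ww zz kE.
  have : par z w by apply: (@par_unit _ z w (D^-1 * k)) => //; rewrite -scalerA -kE scalerA mulVf ?scale1r // gt_eqF.
  have : dot z (D *: w) = k by rewrite kE dotZr zz mulr1.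
  rewrite dotZr => h [] wE; move: h; rewrite wE ?dotNr zz ?mulr1 ?mulrN1 => <-.
    by split => //; split; [rewrite ltNge ltW|rewrite gt_eqF].
  split; first by rewrite oppr_gt0 ltNge ltW.
  by split => //; rewrite oppr_eq0 gt_eqF.
case: (du) => pu _ Vpu; case: (dv) => pv _ Vpv.
apply: (@levels_split allc n nn wneg wpos O1 O2 pu pv).
- by apply: openI; apply: open_pos.
- by apply: openU; apply: openI; apply: open_pos => //; exact: cont_oppR.
- apply/seteqP; split => // w [] [] /= h1 h2 [] [] /= h3 h4; lra.
- move=> p np; have ww := V_unit hV p; have := DE _ np.
  have ED : E (V p) = b * A (V p) - a * B (V p) by [].
  move: ED (ww); rewrite /O1 /O2 /setU /setI /=.
  have [Eg|El|E0] := ltgtP (E (V p)) 0 => ED _ Dw.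
  + have [Bp|Bn|B0] := ltgtP (B (V p)) 0.
    * by right; right; split; nra.
    * by right; left; split; lra.
    * move: Dw; rewrite B0 scale0r addr0 => Dw.
      have [_ [h _]] := unitD _ _ _ ww uu Dw.
      by case: (anti u du p); apply: h; nra.
  + have [Ap|An|A0] := ltgtP (A (V p)) 0.
    * by right; right; split; nra.
    * by left.
    * move: Dw; rewrite A0 scale0r add0r => Dw.
      have [_ [h _]] := unitD _ _ _ ww vv Dw.
      by case: (anti v dv p); apply: h; nra.
  + have Dw' : D *: V p = (A (V p) / a) *: x.
      have -> : D *: V p = A (V p) *: u + B (V p) *: v by [].
      have -> : B (V p) = A (V p) / a * b by have an0 : a != 0 by [rewrite gt_eqF]; apply: (mulfI an0); rewrite mulrA mulrCA divff ?mulr1 //; lra.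
      by rewrite xE; apply/rowP => i; rewrite !mxE; field; rewrite gt_eqF.
    have [h1 [_ h3]] := unitD _ _ _ ww xx Dw'.
    have [An|Ap|A0] := ltgtP (A (V p)) 0.
    * by right; right; split; nra.
    * by case: ndx; exists p => //; apply: h1; rewrite divr_gt0.
    * by move: h3; rewrite A0 mul0r eqxx.
- by rewrite Vpu dotC.
- by rewrite Vpu /O1; split; rewrite /= /E Au ?Bu //; nra.
- by rewrite Vpv dotC.
- by rewrite Vpv /O2; left; split; rewrite /= /E ?Av Bv //; nra.
Qed.

End GeodConvex.

(** * Rays, nearest points, and the structure of 1-parameter fibrations *)

Section RaysAndProjections.
Variable R : realType.
Implicit Types (u v e n k l x y z p q w : 'rV[R]_3) (a b c s t : R).

(** Connectedness of a segment, for two closed sets. *)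
Lemma closed_cover_meet (C1 C2 : set R) a b : closed C1 -> closed C2 -> a <= b ->
  C1 a -> C2 b -> (forall t, a <= t <= b -> C1 t \/ C2 t) ->
  exists t, C1 t /\ C2 t.
Proof.
move=> c1 c2 ab C1a C2b cov.
have [C1b|C1b] := pselect (C1 b); first by exists b.
have [s [as_ sb C1s Hs]] := last_point_in c1 ab C1a C1b.
have [C2s|C2s] := pselect (C2 s); first by exists s.
have [s' [ss' s'b C2s' Hs']] := first_point_in c2 (ltW sb) C2b C2s.
exfalso; case: (cov ((s + s') / 2)); first by apply/andP; split; lra.
  by apply: Hs; apply/andP; split; lra.
by apply: Hs'; apply/andP; split; lra.
Qed.

Lemma near_pos (T : topologicalType) (f : T -> R) (z : T) :
  continuous f -> 0 < f z -> \forall z' \near z, 0 < f z'.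
Proof. by move=> cf fz; have := open_pos cf; rewrite openE => /(_ z fz). Qed.

(** By compactness of the segment, through the tube lemma. *)
Lemma closed_proj (f : R * R -> R) a b : continuous f ->
  closed [set s | exists2 c, a <= c <= b & f (s, c) = 0].
Proof.
move=> cf; rewrite -openC openE => s ns.
have /compact_near_coveringP cK := @segment_compact R a b.
have : \forall s' \near s, `[a, b]%classic `<=` (fun c => 0 < f (s', c) ^+ 2).
  apply: (cK R (nbhs s) (fun s' c => 0 < f (s', c) ^+ 2)) => x; rewrite /= in_itv /= => xab.
  have fx : f (s, x) != 0 by apply/eqP => h; apply: ns; exists x.
  have c1 : continuous (fun z : R * R => f (z.2, z.1) ^+ 2).
    have c0 : continuous (fun z : R * R => f (z.2, z.1)).
      apply: (@cont_comp _ _ _ (fun z : R * R => (z.2, z.1)) f) => //.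
      by apply: cont_pair => z; [exact: cvg_snd|exact: cvg_fst].
    exact: cont_mulR.
  have := @near_pos _ _ (x, s) c1; rewrite /= exprn_even_gt0 //= => /(_ fx).
  by apply: filterS => -[].
apply: filterS => s' h [x xab fx].
by have := h x; rewrite /= in_itv /= => /(_ xab); rewrite fx expr0n ltxx.
Qed.

Lemma sphere_compact : compact [set w : 'rV[R]_3 | dot w w = 1].
Proof.
apply: (@compact_ebounded _ _ 1); last by move=> w /= h; rewrite enorm_le // expr1n h.
rewrite (_ : [set w | _] = [set w | dot w w - 1 = 0]); last first.
  by apply/seteqP; split => w /= h; [rewrite h subrr|apply/eqP; rewrite -subr_eq0 h].
apply: closed_zero; apply: cont_addR; last exact: cont_const.
by apply: cont_dot; exact: cont_id.
Qed.

(** Otherwise each direction leaves the set before some time, and by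
    compactness of the sphere before a common time [r]; a point of the set at a
    distance larger than [r] contradicts convexity. *)
Lemma unbounded_ray (A : set 'rV[R]_3) z : closed A ->
  (forall x y s, A x -> A y -> 0 <= s <= 1 -> A (x + s *: (y - x))) ->
  ~ compact A -> A z ->
  exists2 w, dot w w = 1 & forall t, 0 <= t -> A (z + t *: w).
Proof.
move=> cA convA ncA Az; apply: contrapT => nray.
have H w : dot w w = 1 -> exists2 t, 0 <= t & ~ A (z + t *: w).
  move=> ww; apply: contrapT => h; apply: nray; exists w => // t t0.
  by apply: contrapT => nA; apply: h; exists t.
have /compact_near_coveringP cK := sphere_compact.
have : \forall r \near +oo%R, [set w : 'rV[R]_3 | dot w w = 1] `<=`
    (fun w => exists2 t, 0 <= t <= r & ~ A (z + t *: w)).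
  apply: (cK R +oo%R (fun r w => exists2 t, 0 <= t <= r & ~ A (z + t *: w))) => w /H [t t0 nA].
  have o : open [set w' | ~ A (z + t *: w')].
    have := closed_openC cA; apply: (@open_comp _ _ (fun w' => z + t *: w')) => x _.
    apply: cont_add; first exact: cont_const.
    by apply: cont_scale; [exact: cont_const|exact: cont_id].
  have n1 : nbhs w [set w' | ~ A (z + t *: w')] by apply: open_nbhs_nbhs.
  have n2 : (+oo%R : set_system R) [set r | t <= r] by apply: nbhs_pinfty_ge; exact: num_real.
  exists ([set w' | ~ A (z + t *: w')], [set r | t <= r]); first by split.
  by move=> [w' r] [/= h1 h2]; exists t => //; rewrite t0.
move=> nr; have n0 : \forall r \near +oo%R, (0 : R) <= r by apply: nbhs_pinfty_ge; exact: num_real.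
have [r [Hr r0]] := filter_ex (filterI nr n0).
apply: ncA; apply: (@compact_ebounded _ _ (enorm z + r)) => // x Ax.
suff : enorm (x - z) <= r.
  by move=> h; rewrite -[x](subrK z) addrC; apply: le_trans (enormD _ _) _; rewrite lerD2l.
rewrite leNgt; apply/negP => rx.
have L0 : 0 < enorm (x - z) by apply: le_lt_trans rx.
have ww : dot ((enorm (x - z))^-1 *: (x - z)) ((enorm (x - z))^-1 *: (x - z)) = 1.
  by rewrite dotZl dotZr -enorm_sqr; field; rewrite gt_eqF.
have [t /andP[t0 tr]] := Hr _ ww; apply.
rewrite scalerA; apply: convA => //.
by rewrite divr_ge0 ?enorm_ge0 //= ler_pdivrMr // mul1r (le_trans tr) // ltW.
Qed.

(** The form [x |-> (z - o) . x] separates [o] from [A], when [o] is not in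
    [A]. *)
Lemma nearest_point (A : set 'rV[R]_3) (o a0 : 'rV[R]_3) : closed A -> A a0 ->
  (forall x y s, A x -> A y -> 0 <= s <= 1 -> A (x + s *: (y - x))) ->
  exists2 z, A z & forall x, A x -> 0 <= dot (z - o) (x - z).
Proof.
move=> cA Aa convA.
pose f x := dot (x - o) (x - o).
have cf : continuous f.
  by apply: cont_dot; apply: cont_add; [exact: cont_id|exact: cont_const|exact: cont_id|exact: cont_const].
pose B := A `&` [set x | 0 <= f a0 - f x].
have cB : compact B.
  apply: (@compact_ebounded _ _ (enorm o + enorm (a0 - o))).
    apply: closedI => //; apply: closed_nneg; apply: cont_addR; first exact: cont_const.
    exact: cont_oppR.
  move=> x [_] /=; rewrite subr_ge0 => h.
  rewrite -[x](subrK o) addrC; apply: le_trans (enormD _ _) _; rewrite lerD2l.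
  by rewrite enorm_le ?enorm_ge0 // enorm_sqr.
have B0 : B !=set0 by exists a0; split => //=; rewrite subrr.
have [z] := compact_EVT_min B0 cB (continuous_subspaceT cf).
rewrite inE => -[Az zmin'] zmin.
have zm x : A x -> f z <= f x.
  move=> Ax; have [h|h] := leP (f x) (f a0).
    by apply: zmin; rewrite inE; split => //=; rewrite subr_ge0.
  by apply: le_trans (ltW h); rewrite -subr_ge0.
exists z => // x Ax; rewrite leNgt; apply/negP => neg.
set g := dot (z - o) (x - z) in neg; pose m := dot (x - z) (x - z).
have m0 : 0 <= m by exact: dot_ge0.
have fs s : f (z + s *: (x - z)) = f z + 2 * s * g + s ^+ 2 * m.
  rewrite /f /g /m; have -> : z + s *: (x - z) - o = (z - o) + s *: (x - z).
    by apply/rowP => i; rewrite !mxE; ring.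
  by move: (z - o) (x - z) => a b; dring.
have key s : 0 < s <= 1 -> 0 <= 2 * g + s * m.
  move=> /andP[s0 s1]; have s01 : 0 <= s <= 1 by rewrite ltW.
  have := zm _ (convA _ _ _ Az Ax s01); rewrite fs => h.
  by rewrite -(pmulr_rge0 _ s0); lra.
have m1 : 0 < m.
  by have := key 1; rewrite ltr01 lexx => /(_ isT); lra.
have [h|h] := leP m (- g).
  by have := key 1; rewrite ltr01 lexx => /(_ isT); lra.
have := key (- g / m); rewrite divr_gt0 ?oppr_gt0 // ler_pdivrMr // mul1r ltW // => /(_ isT).
by rewrite divfK ?gt_eqF //; lra.
Qed.

End RaysAndProjections.

Section UnionLines.
Variables (R : realType) (V : 'rV[R]_3 -> 'rV[R]_3).
Hypothesis hV : line_fibration V.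
Implicit Types (u v e n k l x y z p q w : 'rV[R]_3) (a b c s t : R).

Lemma one_parameter_dot : one_parameter V ->
  exists2 n : 'rV[R]_3, n != 0 & forall p, dot n (V p) = 0.
Proof.
move=> [n n0 H]; exists n => // p; have [t Ht] := H p.
have h0 : dot n (p + 0 *: V p) = t by apply: Ht; exists 0.
have h1 : dot n (p + 1 *: V p) = t by apply: Ht; exists 1.
move: h0 h1; rewrite !dotL; lra.
Qed.

(** Each plane is filled with parallel fibers, and by continuity they have the
    same orientation. *)
Lemma one_parameter_lines u : one_parameter V -> dirs V u ->
  union_of_lines (Sdir V u).
Proof.
move=> /one_parameter_dot [n n0 nV] du.
have uu := dirs_unit hV du.
have nu : dot n u = 0 by case: du => p _ <-.
pose w := cross n u.
have ww : dot w w = dot n n by rewrite crossL uu nu; ring.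
have nn0 : 0 < dot n n by exact: dot_gt0.
pose r := (Num.sqrt (dot n n))^-1.
have r2 : r ^+ 2 * dot n n = 1.
  by rewrite /r exprVn sqr_sqrtr ?mulVf ?gt_eqF // ltW.
pose e := r *: w.
have ue : dot u e = 0 by rewrite dotZr cross_dotr mulr0.
have F : unit_frame u e.
  by split => //; rewrite dotZl dotZr ww mulrA -expr2.
have eE : cross u e = r *: n.
  transitivity (r *: (dot u u *: n - dot n u *: u)); first by rewrite /e /w; vring.
  by rewrite uu nu scale0r subr0 scale1r.
have e0 : e != 0 by have [_ ee _] := F; rewrite -dot_eq0 ee oner_eq0.
have Vline p s : V p = u -> V (p + s *: e) = u.
  move=> Vp.
  have pr t : par u (V (p + t *: e)).
    apply: (@plane_par _ V hV u e p _ F).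
    - by rewrite dotDr dotZr (dotC (cross u e) e) cross_dotr mulr0 addr0.
    - by left.
    - by rewrite eE dotZl nV mulr0.
  case: (pr s) => // Vs.
  have c : continuous (fun t => dot u (V (p + (t * s) *: e))).
    apply: (@cont_comp _ _ _ (fun t => p + (t * s) *: e) (fun w => dot u (V w))).
      apply: cont_add; first exact: cont_const.
      by apply: cont_scale; [apply: cont_mulR; [exact: cont_id|exact: cont_const]|exact: cont_const].
    exact: cont_dotV.
  have [||t _ t0] := ivt0 c (a := 0) (b := 1); first exact: ler01.
    by rewrite mul0r scale0r addr0 Vp mul1r Vs dotNr uu; lra.
  by exfalso; case: (pr (t * s)) => E; move: t0; rewrite E ?dotNr uu; lra.
exists [set L | is_line L /\ L `<=` Sdir V u]; split.
- have [p [pu Vp]] := Sdir_nonempty hV du.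
  exists (line p e); split; first by exists p, e.
  move=> _ [t _ <-]; split; last exact: Vline.
  by move: pu; rewrite /plane /= dotDr dotZr ue => ->; ring.
- by move=> L [].
apply/seteqP; split => p; last by move=> [L [_ LS] Lp]; exact: LS.
move=> [pu Vp]; exists (line p e).
  split; first by exists p, e.
  move=> _ [t _ <-]; split; last exact: Vline.
  by move: pu; rewrite /plane /= dotDr dotZr ue => ->; ring.
by exists 0; rewrite ?scale0r ?addr0.
Qed.

(** The fibers through this line fill a plane. *)
Lemma parallel_line_one_parameter p w : w != 0 -> dot (V p) w = 0 ->
  (forall t, V (p + t *: w) = V p) -> one_parameter V.
Proof.
move=> w0 uw Vw; pose k := cross (V p) w.
have k0 : k != 0.
  by rewrite -dot_eq0 /k crossL V_unit // uw expr0n subr0 mul1r dot_eq0.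
apply: (@tangent_plane_one_parameter _ V hV k (dot k p)) => // x kx.
have [||| s [t E]] := @coplanar_span _ k (V p) w (x - p) k0 _ _ _ k0.
- by rewrite cross_dotl.
- by rewrite cross_dotr.
- by rewrite dotC !dotL kx subrr.
have -> : x = (p + t *: w) + s *: V (p + t *: w).
  by rewrite Vw -{1}[x](subrK p) E; apply/rowP => i; rewrite !mxE; ring.
by rewrite V_flow // Vw dotC cross_dotl.
Qed.

Lemma Vinv_closed v : closed [set p | V p = v].
Proof.
rewrite (_ : [set p | _] = [set p | dot (V p - v) (V p - v) = 0]); last first.
  apply/seteqP; split => p /=; first by move=> ->; rewrite subrr dot0l.
  by move/eqP; rewrite dot_eq0 subr_eq0 => /eqP.
by apply: closed_zero; apply: cont_dot; apply: cont_add;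
  [exact: V_cont|exact: cont_const|exact: V_cont|exact: cont_const].
Qed.

Lemma Sdir_closed u : closed (Sdir V u).
Proof.
apply: closedI; last exact: Vinv_closed.
exact: (closed_zero (@cont_dotc _ u)).
Qed.

End UnionLines.

(** * Rays in the noncompact case *)

Section NonCompact.
Variables (R : realType) (V : 'rV[R]_3 -> 'rV[R]_3).
Hypothesis hV : line_fibration V.
Hypothesis h1 : ~ one_parameter V.
Implicit Types (u v e n k l x y z p q w c : 'rV[R]_3) (a b s t : R).

Definition V_ray p w := forall t, 0 <= t -> V (p + t *: w) = V p.

Lemma V_convexS v x y s : V x = v -> V y = v -> 0 <= s <= 1 ->
  V (x + s *: (y - x)) = v.
Proof. by move=> Vx Vy s01; rewrite V_convex ?Vx ?Vy. Qed.

(** The ray does not extend to a line on which [V] is constant, so some point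
    [p + t c] with [t < 0] is outside the closed convex set [V^-1(V p)]; the
    form [l] separates this point from the set. *)
Lemma ray_functional p c : c != 0 -> dot (V p) c = 0 -> V_ray p c ->
  exists l m, [/\ dot (V p) l = 0, 0 < dot l c & forall x, V x = V p -> m <= dot l x].
Proof.
move=> c0 uc ray; set u := V p in uc *.
have uu : dot u u = 1 by exact: V_unit.
have [t nt] : exists t, V (p + t *: c) <> u.
  apply: contrapT => h; apply: h1; apply: (parallel_line_one_parameter hV c0 uc) => t.
  by apply: contrapT => h'; apply: h; exists t.
have t0 : t < 0 by rewrite ltNge; apply/negP => t0; apply: nt; exact: ray.
have [z Vz zmin] := @nearest_point _ [set x | V x = u] (p + t *: c) p
  (@Vinv_closed _ V hV u) erefl (@V_convexS u).
set l := z - _ in zmin.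
have ul : dot u l = 0.
  have Vzs s : V (z + s *: u) = u by rewrite V_par_flow // Vz; left.
  have := zmin _ (Vzs 1); have := zmin _ (Vzs (-1)).
  have E s : z + s *: u - z = s *: u by rewrite addrC addKr.
  by rewrite !E !dotZr (dotC l); lra.
have l0 : 0 < dot l l.
  apply: dot_gt0; apply/eqP => l0; apply: nt.
  by rewrite -Vz -[z](subrK (p + t *: c)) -/l l0 add0r.
exists l, (dot l z); split => //.
  have := zmin p erefl.
  have -> : p - z = - l - t *: c by rewrite /l; apply/rowP => i; rewrite !mxE; ring.
  by rewrite dotDr !dotNr dotZr => h; nra.
by move=> x Vx; have := zmin x Vx; rewrite dotDr dotNr; lra.
Qed.

Lemma bounded_ray_ge0 p c l (m : R) : V_ray p c ->
  (forall x, V x = V p -> m <= dot l x) -> 0 <= dot l c.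
Proof.
move=> ray lm; rewrite leNgt; apply/negP => neg.
pose t := (dot l p - m + 1) / - dot l c.
have nn : 0 < - dot l c by rewrite oppr_gt0.
have lp : m <= dot l p by exact: lm.
have t0 : 0 <= t by rewrite divr_ge0 // ?(ltW nn) //; lra.
have := lm _ (ray t t0); rewrite !dotL.
have -> : t * dot l c = - (dot l p - m + 1) by rewrite /t; field; rewrite lt_eqF.
lra.
Qed.

Hypothesis hnc : forall u, dirs V u -> ~ compact (Sdir V u).

Lemma ray_in (B : set 'rV[R]_3) u z : closed B -> B `<=` Sdir V u -> B z ->
  (forall x y s, B x -> B y -> 0 <= s <= 1 -> B (x + s *: (y - x))) ->
  ~ compact B ->
  exists2 w, dot w w = 1 & dot u w = 0 /\ forall t, 0 <= t -> B (z + t *: w).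
Proof.
move=> cB BS Bz convB nB; have [w ww H] := unbounded_ray cB convB nB Bz.
exists w => //; split => //.
have [h1' _] := BS _ (H 1 ler01); have [h2 _] := BS _ Bz.
by move: h1' h2; rewrite /plane /= !dotL; lra.
Qed.

(** [S_u] is an unbounded closed convex set; the ray found in it is carried to
    [p] along the fibers. *)
Lemma ray_at p : exists2 w, dot w w = 1 & dot (V p) w = 0 /\ V_ray p w.
Proof.
have du : dirs V (V p) by exists p.
have uu : dot (V p) (V p) = 1 by exact: V_unit.
have Sz : Sdir V (V p) (p + (- dot (V p) p) *: V p).
  by split; [rewrite /plane /= !dotL uu; ring|rewrite /= V_flow].
have [w ww [uw H]] := ray_in (Sdir_closed hV (u := V p)) (@subset_refl _ _) Sz
   (Sdir_seg hV h1 (u := V p)) (hnc du).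
exists w => //; split => // t t0.
have [_ /= Vt] := H t t0.
rewrite -[RHS]Vt -[LHS](V_flow hV _ (- dot (V p) p)).
have -> : V (p + t *: w) = V p; last by congr V; apply/rowP => i; rewrite !mxE; ring.
rewrite -[RHS]Vt (_ : p + t *: w = (p + (- dot (V p) p) *: V p + t *: w) + dot (V p) p *: V p).
  by rewrite V_par_flow // Vt; left.
by apply/rowP => i; rewrite !mxE; ring.
Qed.

(** A form given by [ray_functional] is nonnegative on all recession
    directions of [S_u]. It vanishes on at most one of them up to a factor,
    because [S_u] lies in a plane; adding a form that is positive there gives
    [l]. *)
Lemma strict_functional p0 : exists l m,
  [/\ dot (V p0) l = 0, dot l l = 1,
      forall x, V x = V p0 -> m <= dot l x &
      forall p c, V p = V p0 -> c != 0 -> dot (V p0) c = 0 -> V_ray p c -> 0 < dot l c].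
Proof.
set u := V p0; have uu : dot u u = 1 by exact: V_unit.
have nz w : dot w w = 1 -> w != 0 by move=> ww; rewrite -dot_eq0 ww oner_eq0.
suff [l [m [ul l0 lm lc]]] : exists l m, [/\ dot u l = 0, l != 0,
      forall x, V x = u -> m <= dot l x &
      forall p c, V p = u -> c != 0 -> dot u c = 0 -> V_ray p c -> 0 < dot l c].
  have L0 : 0 < (enorm l)^-1 by rewrite invr_gt0 sqrtr_gt0 dot_gt0.
  exists ((enorm l)^-1 *: l), ((enorm l)^-1 * m); split.
  - by rewrite dotZr ul mulr0.
  - by rewrite dotZl dotZr -enorm_sqr; field; rewrite -invr_eq0 gt_eqF.
  - by move=> x Vx; rewrite dotZl ler_pM2l // lm.
  - by move=> p c Vp c0 uc ray; rewrite dotZl mulr_gt0 // (lc p).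
have [c0 cc0 [uc0 ray0]] := ray_at p0.
have [l0 [m0 [ul0 lc0 lm0]]] := ray_functional (nz _ cc0) uc0 ray0.
have l00 : l0 != 0 by apply: contraTneq lc0 => ->; rewrite dot0l ltxx.
have [H|H] := pselect (forall p c, V p = u -> c != 0 -> dot u c = 0 -> V_ray p c -> 0 < dot l0 c).
  by exists l0, m0.
have [p1 [c1 [Vp1 c10 uc1 ray1 nl]]] : exists p1 c1, [/\ V p1 = u, c1 != 0, dot u c1 = 0,
    V_ray p1 c1 & ~ 0 < dot l0 c1].
  apply: contrapT => h; apply: H => p c Vp c00 uc ray.
  by apply: contrapT => h'; apply: h; exists p, c.
have uc1' : dot (V p1) c1 = 0 by rewrite Vp1.
have [l1 [m1 [ul1 lc1 lm1]]] := ray_functional c10 uc1' ray1.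
rewrite Vp1 in ul1 lm1.
have l0c1 : dot l0 c1 = 0.
  have := @bounded_ray_ge0 p1 c1 l0 m0 ray1; rewrite Vp1 => /(_ lm0).
  by move/negP: nl; rewrite -leNgt => ? ?; apply/eqP; rewrite eq_le; apply/andP.
exists (l0 + l1), (m0 + m1); split.
- by rewrite dotDr ul0 ul1 addr0.
- apply: contraTneq lc1 => E; have := congr1 (fun x => dot x c1) E.
  by rewrite dotDl l0c1 add0r dot0l => ->; rewrite ltxx.
- by move=> x Vx; rewrite dotDl lerD ?lm0 ?lm1.
move=> p c Vp c00 uc ray; rewrite dotDl.
have g0 : 0 <= dot l0 c by apply: (@bounded_ray_ge0 p c l0 m0 ray); rewrite Vp.
have g1 : 0 <= dot l1 c by apply: (@bounded_ray_ge0 p c l1 m1 ray); rewrite Vp.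
have [l0c|l0c] := eqVneq (dot l0 c) 0; last first.
  by rewrite ltr_pwDl // lt_neqAle eq_sym l0c.
rewrite l0c add0r lt_neqAle g1 andbT eq_sym; apply/eqP => l1c.
pose k := cross u l0.
have kE x : dot u x = 0 -> dot l0 x = 0 -> dot k k *: x = dot k x *: k.
  by move=> ux lx; rewrite /k cramer ux lx !scale0r !add0r.
have k0 : 0 < dot k k.
  by rewrite /k crossL uu ul0 expr0n subr0 mul1r dot_gt0.
have k1 := congr1 (dot l1) (kE _ uc1 l0c1).
have k2 := congr1 (dot l1) (kE _ uc l0c).
move: k1 k2; rewrite !dotZr l1c mulr0 => k1 /esym/eqP; rewrite mulf_eq0 => /orP[] /eqP h.
  have := kE _ uc l0c; rewrite h scale0r => /eqP.
  by rewrite scaler_eq0 gt_eqF // (negbTE c00).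
by have := mulr_gt0 k0 lc1; rewrite k1 h mulr0 ltxx.
Qed.

(** The part of [S_u] where [l] is below some value is compact, as it contains
    no ray. *)
Lemma functional_min p0 l : dot (V p0) l = 0 ->
  (forall p c, V p = V p0 -> c != 0 -> dot (V p0) c = 0 -> V_ray p c -> 0 < dot l c) ->
  exists2 z, V z = V p0 & forall x, V x = V p0 -> dot l z <= dot l x.
Proof.
move=> ul lc; set u := V p0 in ul lc *.
have uu : dot u u = 1 by exact: V_unit.
have pS x : V x = u -> Sdir V u (x + (- dot u x) *: u).
  move=> Vx; split; first by rewrite /plane /= !dotL uu; ring.
  by rewrite /= V_par_flow // Vx; left.
have Sz := pS p0 erefl; set z0 := _ + _ in Sz; clearbody z0.
pose B := Sdir V u `&` [set x | 0 <= dot l z0 - dot l x].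
have Bz : B z0 by split => //=; rewrite subrr.
have cl : continuous (fun x => dot l x) by exact: cont_dotc.
have cB : closed B.
  apply: closedI; first exact: Sdir_closed.
  apply: closed_nneg; apply: cont_addR; first exact: cont_const.
  exact: cont_oppR.
have [ncB|ncB] := pselect (compact B); last first.
  have convB x y s : B x -> B y -> 0 <= s <= 1 -> B (x + s *: (y - x)).
    move=> [Sx /= lx] [Sy /= ly] /andP[s0 s1]; split; first by apply: Sdir_seg => //; rewrite s0.
    rewrite /= !dotL; nra.
  have BS : B `<=` Sdir V u by move=> x [].
  have [w ww [uw H]] := ray_in cB BS Bz convB ncB.
  have Vz0 : V z0 = u by case: Sz.
  have := lc z0 w Vz0 _ uw.
  rewrite -dot_eq0 ww oner_eq0 => /(_ isT) h.
  have : 0 < dot l w by apply: h => t t0; have [[_ /= ->] _] := H t t0.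
  by have [_] := H 1 ler01; rewrite /= !dotL; lra.
have [z] := compact_EVT_min (ex_intro _ z0 Bz) ncB (continuous_subspaceT cl).
rewrite inE => -[[_ /= Vz] /= lz] zmin; exists z => // x Vx.
have lx : dot l (x + (- dot u x) *: u) = dot l x by rewrite !dotL (dotC l u) ul mulr0 addr0.
rewrite -lx; have [h|h] := leP (dot l (x + (- dot u x) *: u)) (dot l z0).
  by apply: zmin; rewrite inE; split; [exact: pS|rewrite /= subr_ge0].
by apply: le_trans (ltW h); rewrite -subr_ge0.
Qed.

(** A ray given by [ray_at] at a point near [z] has its direction near the
    compact set of recession directions at [z], on which [l] is positive. Its
    direction is then corrected along the fiber to be orthogonal to [V z]. *)
Lemma local_rays z l e : dot (V z) l = 0 -> dot e e = 1 ->
  (forall c, c != 0 -> dot (V z) c = 0 -> V_ray z c -> 0 < dot l c) ->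
  exists2 d : R, 0 < d & forall q, `|z - q| < d ->
    exists w, [/\ dot (V z) w = 0, d <= dot l w, `|dot e w| <= 2 & V_ray q w].
Proof.
move=> ul ee lc; set u := V z in ul lc *.
have uu : dot u u = 1 by exact: V_unit.
have /compact_near_coveringP cK := @sphere_compact R.
(* the properties of the corrected direction, multiplied by [f = u . V q] *)
pose P (i : 'rV[R]_3 * R) w := dot (V i.1) w = 0 -> V_ray i.1 w ->
  let f := dot u (V i.1) in
  [/\ 0 < f, i.2 * f < dot l w * f - dot u w * dot l (V i.1) &
     (dot e w * f - dot u w * dot e (V i.1)) ^+ 2 < 4 * f ^+ 2].
have : \forall i \near (z, 0 : R), [set w : 'rV[R]_3 | dot w w = 1] `<=` P i.
  apply: (cK _ (nbhs (z, 0 : R)) P) => w0 /= ww0.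
  pose T := ('rV[R]_3 * ('rV[R]_3 * R))%type.
  have c1 : continuous (fun i : T => i.1) by move=> i; exact: cvg_fst.
  have c2 : continuous (fun i : T => i.2) by move=> i; exact: cvg_snd.
  have c21 : continuous (fun i : T => i.2.1).
    by apply: (@cont_comp _ _ _ (fun i : T => i.2) fst) => // i; exact: cvg_fst.
  have c22 : continuous (fun i : T => i.2.2).
    by apply: (@cont_comp _ _ _ (fun i : T => i.2) snd) => // i; exact: cvg_snd.
  have cV : continuous (fun i : T => V i.2.1).
    by apply: (@cont_comp _ _ _ (fun i : T => i.2.1) V) => //; exact: V_cont.
  have cdw x : continuous (fun i : T => dot x i.1) by apply: cont_dot => //; exact: cont_const.
  have cdV x : continuous (fun i : T => dot x (V i.2.1)).
    by apply: cont_dot => //; exact: cont_const.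
  have split (G : T -> Prop) : (\forall i \near (w0, (z, 0 : R)), G i) ->
     \forall w \near w0 & i \near (z, 0 : R), G (w, i).
    by apply: filterS => -[].
  have [uw0|uw0] := eqVneq (dot u w0) 0; last first.
    have cc : continuous (fun i : T => dot (V i.2.1) i.1 ^+ 2).
      have c : continuous (fun i : T => dot (V i.2.1) i.1) by exact: cont_dot.
      exact: cont_mulR.
    have := @near_pos _ _ _ (w0, (z, 0 : R)) cc; rewrite /= -/u exprn_even_gt0 //= => /(_ uw0).
    move/split; apply: filterS => -[w i] /= h E _.
    by move: h; rewrite E expr0n ltxx.
  have [ray|nray] := pselect (V_ray z w0); last first.
    have [t [t0 nt]] : exists t, 0 <= t /\ V (z + t *: w0) <> V z.
      apply: contrapT => h; apply: nray => t t0; apply: contrapT => h'.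
      by apply: h; exists t.
    have cc : continuous (fun i : T => dot (V (i.2.1 + t *: i.1) - V i.2.1) (V (i.2.1 + t *: i.1) - V i.2.1)).
      have c : continuous (fun i : T => V (i.2.1 + t *: i.1) - V i.2.1).
        apply: cont_add; last exact: cont_opp.
        apply: (@cont_comp _ _ _ (fun i : T => i.2.1 + t *: i.1) V); last exact: V_cont.
        by apply: cont_add => //; apply: cont_scale => //; exact: cont_const.
      exact: cont_dot.
    have := @near_pos _ _ _ (w0, (z, 0 : R)) cc; rewrite /=.
    have n0 : V (z + t *: w0) - V z != 0 by rewrite subr_eq0; apply/eqP.
    move/(_ (dot_gt0 n0)).
    move/split; apply: filterS => -[w i] /= h E ray.
    by move: h; rewrite (ray t t0) subrr dot0l ltxx.
  have w00 : w0 != 0 by rewrite -dot_eq0 ww0 oner_eq0.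
  have lw0 := lc w0 w00 uw0 ray.
  have n1 : \forall i \near (w0, (z, 0 : R)), 0 < dot u (V i.2.1).
    by apply: near_pos => //=; rewrite -/u uu.
  have n2 : \forall i \near (w0, (z, 0 : R)), 0 < dot l i.1 * dot u (V i.2.1)
      - dot u i.1 * dot l (V i.2.1) - i.2.2 * dot u (V i.2.1).
    apply: near_pos; last by rewrite /= -/u uu uw0 mul0r mul0r !subr0 mulr1.
    apply: cont_addR; last by apply: cont_oppR; exact: cont_mulR.
    by apply: cont_addR; [exact: cont_mulR|apply: cont_oppR; exact: cont_mulR].
  have n3 : \forall i \near (w0, (z, 0 : R)), 0 < 4 * (dot u (V i.2.1) * dot u (V i.2.1)) -
    (dot e i.1 * dot u (V i.2.1) - dot u i.1 * dot e (V i.2.1)) *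
    (dot e i.1 * dot u (V i.2.1) - dot u i.1 * dot e (V i.2.1)).
    have cc : continuous (fun i : T => dot e i.1 * dot u (V i.2.1) - dot u i.1 * dot e (V i.2.1)).
      by apply: cont_addR; [exact: cont_mulR|apply: cont_oppR; exact: cont_mulR].
    apply: near_pos.
      apply: cont_addR; last by apply: cont_oppR; exact: cont_mulR.
      by apply: cont_mulR; [exact: cont_const|exact: cont_mulR].
    rewrite /= -/u uu uw0; have := cauchy_dot e w0; rewrite ee ww0; lra.
  apply: (split (fun i => P i.2 i.1)); near=> i => _ _ /=; split.
  - by near: i.
  - by rewrite -subr_gt0; near: i.
  - by rewrite -subr_gt0 !expr2; near: i.
move=> nP.
have {nP} [d d0 Hd] : exists2 d : R, 0 < d & forall q, `|z - q| < d ->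
    [set w : 'rV[R]_3 | dot w w = 1] `<=` P (q, d).
  case: nP => -[A B] /= [/nbhs_ballP [r1 /= r10 H1] /nbhs_ballP [r2 /= r20 H2]] HP.
  exists (Num.min (r1 / 2) (r2 / 2)); first by rewrite lt_min !divr_gt0.
  move=> q; rewrite lt_min => /andP[hq _]; apply: (HP (q, _)); split => /=.
    by apply: H1; rewrite -ball_normE /=; apply: lt_trans hq _; lra.
  apply: H2; rewrite -ball_normE /= sub0r normrN gtr0_norm.
    by rewrite gt_min; apply/orP; right; lra.
  by rewrite lt_min !divr_gt0.
exists d => // q hq.
have [w ww [Vw ray]] := ray_at q.
have [f0 hl he] := Hd q hq w ww Vw ray.
rewrite /= in f0 hl he.
have fn0 : dot u (V q) != 0 by rewrite gt_eqF.
pose s := dot u w / dot u (V q).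
have sf : s * dot u (V q) = dot u w by rewrite /s divfK.
exists (w + (- s) *: V q); split.
- by rewrite !dotL mulNr sf subrr.
- rewrite -(ler_pM2r f0); apply: le_trans (ltW hl) _.
  by rewrite !dotL -sf; rewrite le_eqVlt; apply/orP; left; apply/eqP; ring.
- rewrite -(ler_pM2r f0) -[X in _ * X <= _](gtr0_norm f0) -normrM.
  rewrite -ler_sqr ?nnegrE ?normr_ge0 ?mulr_ge0 ?(ltW f0) // real_normK ?num_real //.
  apply: ltW; rewrite [ltRHS]exprMn (_ : 2 ^+ 2 = 4); last by rewrite -natrX.
  by apply: le_lt_trans he; rewrite !dotL -sf; rewrite le_eqVlt; apply/orP; left; apply/eqP; ring.
move=> t t0.
have -> : q + t *: (w + (- s) *: V q) = (q + t *: w) + (- (t * s)) *: V (q + t *: w).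
  by rewrite ray //; apply/rowP => i; rewrite !mxE; ring.
by rewrite V_flow // ray.
Unshelve. all: by end_near.
Qed.

End NonCompact.

Section AllNoncompact.
Variables (R : realType) (V : 'rV[R]_3 -> 'rV[R]_3).
Hypothesis hV : line_fibration V.

(** [T k s] is the point of the plane of [S_u] through [z] with [l]-coordinate
    [k] and [e]-coordinate [s] relative to [z]. Following rays upwards from
    [T (- eta) s] to the level [eta] moves the [e]-coordinate by at most [rho].
    If no point at level [- eta] had direction [u], each [s] would be sent either
    to the left or to the right of a fixed point [x0] of [S_u] at level [eta],
    and by convexity not to both; these are closed conditions, and both
    occur. *)
Lemma noncompact_one_parameter :
  (forall u, dirs V u -> ~ compact (Sdir V u)) -> one_parameter V.
Proof.
move=> hnc; apply: contrapT => h1.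
have [l [m [ul ll lm lc]]] := strict_functional hV h1 hnc 0.
have [z Vz zmin] := functional_min hV h1 ul lc.
set u := V 0 in ul lm lc Vz zmin.
have uu : dot u u = 1 by exact: V_unit.
have F : unit_frame u l by split.
pose e := cross u l.
have ee : dot e e = 1 by rewrite /e crossL uu ll ul; ring.
have ue : dot u e = 0 by exact: cross_dotl.
have le_ : dot l e = 0 by exact: cross_dotr.
have el : dot e l = 0 by rewrite dotC.
have eu : dot e u = 0 by rewrite dotC.
have [|||d d0 Hd] := @local_rays _ V hV h1 hnc z l e.
- by rewrite Vz.
- exact: ee.
- by move=> c c0; rewrite Vz => uc ray; apply: (lc z).
rewrite Vz in Hd.
pose eta := d / (2 * (1 + 8 / d)).
have d8 : 0 < 8 / d by rewrite divr_gt0.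
have eta0 : 0 < eta by rewrite /eta divr_gt0 // mulr_gt0 //; lra.
have etaE : eta * (1 + 8 / d) = d / 2 by rewrite /eta; field; apply/andP; split; lra.
pose rho := 4 * eta / d.
have rhoE : 2 * rho = eta * (8 / d) by rewrite /rho; ring.
have rho0 : 0 < rho by rewrite /rho divr_gt0 // mulr_gt0.
pose T (k s : R) : 'rV[R]_3 := z + k *: l + s *: e.
have lT k s : dot l (T k s) = dot l z + k by rewrite /T !dotDr !dotZr ll le_; ring.
have eT k s : dot e (T k s) = dot e z + s by rewrite /T !dotDr !dotZr ee el; ring.
have uT k s : dot u (T k s) = dot u z by rewrite /T !dotDr !dotZr ue ul; ring.
have cT k : continuous (T k).
  apply: cont_add; first exact: cont_const.
  by apply: cont_scale; [exact: cont_id|exact: cont_const].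
have Tlow s : V (T (- eta) s) <> u.
  by move=> /zmin; rewrite lT; lra.
have step k s : `|z - T k s| < d -> - eta <= k <= eta ->
    exists2 x, `|x - s| <= (eta - k) * 2 / d & V (T eta x) = V (T k s).
  move=> /Hd [w [uw lw ew ray]] /andP[k1 k2].
  have lw0 : 0 < dot l w by apply: lt_le_trans lw.
  pose t := (eta - k) / dot l w.
  have t0 : 0 <= t by rewrite divr_ge0 ?(ltW lw0) ?subr_ge0 //.
  have tl : t * dot l w = eta - k by rewrite /t divfK // gt_eqF.
  exists (s + t * dot e w).
    rewrite addrC addKr normrM ger0_norm //.
    apply: (@le_trans _ _ (t * 2)); first by rewrite ler_wpM2l.
    rewrite [leRHS]mulrAC ler_wpM2r // /t ler_wpM2l ?subr_ge0 //.
    by rewrite lef_pV2.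
  rewrite -(ray t t0); congr V; apply/eqP; rewrite -subr_eq0; apply/eqP.
  have dE x A B : dot x (A - (B + t *: w)) = dot x A - (dot x B + t * dot x w).
    by rewrite !dotL.
  rewrite [LHS](frame_exp _ F) -/e !dE !lT !eT !uT uw tl mulr0.
  by apply/rowP => i; rewrite !mxE; ring.
have [x0 hx0 Vx0] : exists2 x0, `|x0| <= rho / 2 & V (T eta x0) = u.
  have [||x hx Vx] := step 0 0.
  - by rewrite /T !scale0r !addr0 subrr normr0.
  - by apply/andP; split; lra.
  exists x; first by move: hx; rewrite !subr0 /rho => /le_trans; apply; lra.
  by rewrite Vx /T !scale0r !addr0.
have stepT s : `|s| <= 2 * rho -> exists2 x, `|x - s| <= rho & V (T eta x) = V (T (- eta) s).
  move=> hs; have [||x hx Vx] := step (- eta) s.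
  - apply: le_lt_trans (norm_le_enorm _) _.
    have -> : z - T (- eta) s = eta *: l + (- s) *: e.
      by rewrite /T; apply/rowP => i; rewrite !mxE; ring.
    apply: le_lt_trans (enormD _ _) _.
    rewrite !enormZ (enorm_unit ll) (enorm_unit ee) !mulr1 normrN gtr0_norm //.
    apply: (@le_lt_trans _ _ (d / 2)); last by lra.
    by rewrite -etaE mulrDr mulr1 -rhoE lerD2l.
  - by apply/andP; split; lra.
  exists x => //; move: hx; rewrite /rho => /le_trans; apply.
  by rewrite le_eqVlt; apply/orP; left; apply/eqP; ring.
pose f (z : R * R) := dot (V (T eta z.2) - V (T (- eta) z.1)) (V (T eta z.2) - V (T (- eta) z.1)).
have cf : continuous f.
  have c1 : continuous (fun z : R * R => V (T (- eta) z.1)).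
    apply: (@cont_comp _ _ _ (fun z : R * R => T (- eta) z.1) V); last exact: V_cont.
    by apply: (@cont_comp _ _ _ fst (T (- eta))) => // i; exact: cvg_fst.
  have c2 : continuous (fun z : R * R => V (T eta z.2)).
    apply: (@cont_comp _ _ _ (fun z : R * R => T eta z.2) V); last exact: V_cont.
    by apply: (@cont_comp _ _ _ snd (T eta)) => // i; exact: cvg_snd.
  have c3 : continuous (fun z : R * R => V (T eta z.2) - V (T (- eta) z.1)).
    by apply: cont_add; [exact: c2|exact: cont_opp].
  exact: cont_dot.
have fE s x : f (s, x) = 0 <-> V (T eta x) = V (T (- eta) s).
  rewrite /f /=; split; last by move=> ->; rewrite subrr dot0l.
  by move/eqP; rewrite dot_eq0 subr_eq0 => /eqP.
have := @closed_cover_meet R _ _ (- (2 * rho)) (2 * rho)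
  (closed_proj (a := - (3 * rho)) (b := x0) cf) (closed_proj (a := x0) (b := 3 * rho) cf).
have ab (x y : R) : `|x| <= y -> - y <= x /\ x <= y.
  by rewrite ler_norml => /andP.
have [x01 x02] := ab _ _ hx0.
have cover s : - (2 * rho) <= s <= 2 * rho ->
    exists2 x, s - rho <= x <= s + rho & f (s, x) = 0.
  rewrite -ler_norml => /stepT [x /ab [x1 x2] Vx]; exists x; last exact/fE.
  by apply/andP; split; lra.
case.
- lra.
- have [|x /andP[x1 x2] fx] := cover (- (2 * rho)); first by apply/andP; split; lra.
  by exists x => //; apply/andP; split; lra.
- have [|x /andP[x1 x2] fx] := cover (2 * rho); first by apply/andP; split; lra.
  by exists x => //; apply/andP; split; lra.
- move=> s hs; have [x /andP[x1 x2] fx] := cover s hs; case/andP: hs => s1 s2.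
  have [xx|xx] := leP x x0; [left|right]; exists x => //; apply/andP; split; lra.
move=> s [[x /andP[_ xx0] /fE fx] [y /andP[x0y _] /fE fy]].
apply: (Tlow s).
have [E|ne] := eqVneq x x0; first by rewrite -fx E Vx0.
have xy : 0 < y - x by move/eqP: ne; lra.
have lam : 0 <= (x0 - x) / (y - x) <= 1.
  apply/andP; split; last by rewrite ler_pdivrMr // mul1r lerD2r.
  by apply: divr_ge0; [rewrite subr_ge0|exact: ltW].
have := V_convexS hV h1 fx fy lam.
have -> : T eta x + ((x0 - x) / (y - x)) *: (T eta y - T eta x) = T eta x0.
  by rewrite /T; apply/rowP => i; rewrite !mxE; field; rewrite gt_eqF.
by rewrite Vx0.
Qed.

End AllNoncompact.

Unset Implicit Arguments.

Theorem theorem1 (R : realType) (V : 'rV[R]_3 -> 'rV[R]_3)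
    (hV : line_fibration V) :
  [/\ ~ one_parameter V ->
        forall u, dirs V u ->
          convex_set (Sdir V u : set (convex_lmodType 'rV[R]_3)) /\
          connected (Sdir V u),
      forall u, dirs V u -> compact (Sdir V u) ->
        continuous_at_infinity V u /\ ~ dirs V (- u),
      (forall u, dirs V u -> compact (Sdir V u)) ->
        geodesically_convex (dirs V) &
      (forall u, dirs V u -> ~ compact (Sdir V u)) ->
        (forall u, dirs V u -> union_of_lines (Sdir V u)) /\
        one_parameter V].
Proof.
split.
- by move=> h1 u _; split; [exact: Sdir_convex|exact: Sdir_connected].
- by move=> u du cS; split; [exact: compact_continuous_at_infinity|exact: no_antipode].
- exact: dirs_geodesically_convex.
- move=> hnc; have h1 := noncompact_one_parameter hV hnc.
  by split => // u du; exact: one_parameter_lines.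
Qed.
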